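(* Every symmetric SITAwIM of rank $4$ has cyclotomic eigenvalues, i.e. all eigenvalues of the regular matrices of its standard basis elements (equivalently all entries of its character table) are cyclotomic.
   Context: An integral table algebra $(A,\mathbf{B})$ is a finite-dimensional complex algebra $A$ with involution $*$ and a $*$-invariant basis $\mathbf{B}=\{b_0=1,\dots,b_{r-1}\}$ with nonnegative integer structure constants satisfying the pseudo-inverse condition (the coefficient of $1$ in $b_ib_j^*$ is positive iff $b_j=b_i^*$); elements of $\mathbf{B}$ are identified with their left regular matrices. It is standard if for each $b_i$ the coefficient of $1$ in $b_ib_i^*$ equals the maximal eigenvalue $\delta_i$ (degree) of $b_i$; this is a SITA of rank $r=|\mathbf{B}|$ and order $n=\sum_j\delta_j$. It is symmetric if $b_i^*=b_i$ for all $i$. For commutative $A$ let $P=(\chi_i(b_j))$ be the character table, with $\chi_0(b_j)=\delta_j$; the multiplicity $m_i$ of $\chi_i$ is defined by $\sum_{j}|\chi_i(b_j)|^2/\delta_j=n/m_i$. A SITAwIM is a commutative SITA all of whose multiplicities $m_i$ are positive integers. An algebraic number is cyclotomic if it lies in a cyclotomic extension of $\mathbb{Q}$. *)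

(* Defs.v *)
From HB Require Import structures.
From mathcomp Require Import all_boot all_order all_algebra all_field.

Set Implicit Arguments.
Unset Strict Implicit.
Unset Printing Implicit Defensive.

Import Order.TTheory GRing.Theory Num.Theory.

Local Open Scope ring_scope.

(* A basis of rank r = d + 1 is a tuple (b_0, ..., b_d); everything is stated
   over an arbitrary C : numClosedFieldType, of which the complex numbers R[i]
   over a realType R are an instance. *)

Section TableAlgebra.

Variables (C : numClosedFieldType) (A : falgType C) (d : nat).
Implicit Types (star : A -> A) (b : d.+1.-tuple A) (delta : 'I_d.+1 -> C).

(* The involution of a complex algebra is taken conjugate-linear. *)
Definition is_involution star : Prop :=
  [/\ {morph star : x y / x + y},
      forall (a : C) (x : A), star (a *: x) = Num.conj a *: star x,
      forall x y : A, star (x * y) = star y * star x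
    & involutive star].

Definition struct_const b (i j k : 'I_d.+1) : C :=
  coord b k (tnth b i * tnth b j).

(* The coefficient of 1 = b_0. *)
Definition coef1 b (x : A) : C := coord b ord0 x.

(* The pseudo-inverse condition is used in the form "the coefficient of 1 in
   b_i b_j is positive iff b_j = b_i^*"; equivalently, the coefficient of 1 in
   b_i b_j^* is positive iff b_j = b_i.  All these forms agree when * fixes
   the basis. *)
Definition integral_table_algebra star b : Prop :=
  [/\ is_involution star,
      basis_of fullv b /\ tnth b ord0 = 1,
      forall i, star (tnth b i) \in b,
      forall i j k, exists m : nat, struct_const b i j k = m%:R
    & forall i j, 0 < coef1 b (tnth b i * tnth b j) <->
                  tnth b j = star (tnth b i)].

(* Column j holds the coordinates of b_i b_j. *)
Definition regular_mx b (i : 'I_d.+1) : 'M[C]_d.+1 :=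
  \matrix_(k, j) struct_const b i j k.

(* The Perron-Frobenius eigenvalue: the other eigenvalues of a nonnegative
   matrix need not be real, so "maximal" refers to the modulus. *)
Definition is_max_eigenvalue n (M : 'M[C]_n) (x : C) : Prop :=
  eigenvalue M x /\ forall y, eigenvalue M y -> `|y| <= x.

Definition is_degree_map b delta : Prop :=
  forall i, is_max_eigenvalue (regular_mx b i) (delta i).

Definition SITA star b delta : Prop :=
  [/\ integral_table_algebra star b,
      is_degree_map b delta
    & forall i, coef1 b (tnth b i * star (tnth b i)) = delta i].

Definition symmetric_table_algebra star b : Prop :=
  forall i, star (tnth b i) = tnth b i.

Definition order_of delta : C := \sum_i delta i.

(* For commutative A the irreducible characters, i.e. the rows of the character
   table, are the unital algebra morphisms A -> C. *)
Definition is_multiplicity b delta (chi : {lrmorphism A -> C | *%R}) (m : C) :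
    Prop :=
  m != 0 /\
  \sum_j `|chi (tnth b j)| ^+ 2 / delta j = order_of delta / m.

Definition SITAwIM star b delta : Prop :=
  [/\ SITA star b delta,
      forall x y : A, x * y = y * x
    & forall chi : {lrmorphism A -> C | *%R},
        exists2 m : nat, (0 < m)%N & is_multiplicity b delta chi m%:R].

End TableAlgebra.

(* x lies in Q(z) for a root of unity z; as z is algebraic, Q(z) = Q[z]. *)
Definition cyclotomic_number (C : numClosedFieldType) (x : C) : Prop :=
  exists (n : nat) (z : C) (p : {poly rat}),
    n.-primitive_root z /\ x = (map_poly ratr p).[z].

(* Main.v *)
Require Import Defs.
From HB Require Import structures.
From mathcomp Require Import all_boot all_order all_algebra all_field.
From mathcomp Require Import cyclic spectral.
From mathcomp Require Import ring lra zify.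
From mathcomp Require Import boolp reals complex.

Set Implicit Arguments.
Unset Strict Implicit.
Unset Printing Implicit Defensive.

Import Order.TTheory GRing.Theory Num.Theory.

Local Open Scope ring_scope.

(** Let [q] be the cofactor of [X - delta_j] in the characteristic polynomial of
    a standard basis element [b_j].  If [q] has a rational root, the eigenvalues
    of [b_j] are rational or quadratic, hence cyclotomic by quadratic Gauss sums.
    Otherwise [q] is an irreducible cubic, so that [b_j] separates the four
    characters and the three nontrivial ones are Galois conjugate: they have the
    same multiplicity [m].  The orthogonality relations then force every
    nontrivial degree to be [m], so [det P ^ 2 = n ^ 4] and [det P] is rational.
    As [det P] is a nonzero rational multiple of the Vandermonde determinant of
    the eigenvalues of [b_j], the discriminant of [q] is a rational square.

    Cyclic cubics are cyclotomic: the cube of a Lagrange resolvent lies in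
    [Q(w)], with [w] a cube root of unity, and its norm is the cube of a
    rational number.  By descent on the norm such an element has a cyclotomic
    cube root: primes [p = 1 mod 3] are peeled off with the cubic Gauss sum [G],
    which satisfies [G ^ 3 = p * J] for the Jacobi sum [J], an Eisenstein integer
    of norm [p]; this also provides the splitting of [p] in [Z[w]]. *)

(** * Closure properties of cyclotomic numbers *)

Section CyclotomicNumbers.

Variable C : numClosedFieldType.
Implicit Types (x y z : C).

Lemma primitive_root_exists n : (0 < n)%N -> exists z : C, n.-primitive_root z.
Proof.
move=> n_gt0; have [rs Drs] := closed_field_poly_normal ('X^n - 1 : {poly C}).
move: Drs; rewrite (monicP _) ?monicXnsubC // scale1r => Drs.
have rs_unity : all n.-unity_root rs.
  by apply/allP=> z; rewrite -root_prod_XsubC -Drs.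
have rs_uniq : uniq rs.
  by rewrite -separable_prod_XsubC -Drs separable_Xn_sub_1 // pnatr_eq0 -lt0n.
have rs_size : (n <= size rs)%N.
  by rewrite -ltnS -(size_prod_XsubC rs id) -Drs size_XnsubC.
by have /hasP[z _ zP] := has_prim_root n_gt0 rs_unity rs_uniq rs_size; exists z.
Qed.

Lemma cyclotomic_ratr (a : rat) : cyclotomic_number (ratr a : C).
Proof.
have [z zP] := primitive_root_exists (ltn0Sn 0).
by exists 1%N, z, a%:P; rewrite map_polyC hornerC.
Qed.

Lemma cyclotomic_unity_root n z :
  (0 < n)%N -> z ^+ n = 1 -> cyclotomic_number z.
Proof.
move=> n_gt0 zn1; have [w wP] := primitive_root_exists n_gt0.
have [i ->] := prim_rootP wP zn1.
by exists n, w, 'X^i; rewrite map_polyXn hornerXn.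
Qed.

(** Both roots of unity are powers of a primitive root of order [n * m]; composing with ['X^i] and
    ['X^j] rewrites both numbers over that single root. *)
Lemma cyclotomic_common_root x y :
  cyclotomic_number x -> cyclotomic_number y ->
  exists (n : nat) (w : C) (p q : {poly rat}),
    [/\ n.-primitive_root w, x = (map_poly ratr p).[w]
      & y = (map_poly ratr q).[w]].
Proof.
move=> [n [z [p [zP ->]]]] [m [u [q [uP ->]]]].
have nm_gt0 : (0 < n * m)%N.
  by rewrite muln_gt0 (prim_order_gt0 zP) (prim_order_gt0 uP).
have [w wP] := primitive_root_exists nm_gt0.
have [|i ->] := prim_rootP wP (x := z).
  by rewrite exprM (prim_expr_order zP) expr1n.
have [|j ->] := prim_rootP wP (x := u).
  by rewrite mulnC exprM (prim_expr_order uP) expr1n.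
exists (n * m)%N, w, (p \Po 'X^i), (q \Po 'X^j).
by rewrite !map_comp_poly !map_polyXn !horner_comp !hornerXn.
Qed.

Lemma cyclotomicD x y :
  cyclotomic_number x -> cyclotomic_number y -> cyclotomic_number (x + y).
Proof.
move=> hx hy; have [n [w [p [q [wP -> ->]]]]] := cyclotomic_common_root hx hy.
by exists n, w, (p + q); rewrite rmorphD hornerD.
Qed.

Lemma cyclotomicM x y :
  cyclotomic_number x -> cyclotomic_number y -> cyclotomic_number (x * y).
Proof.
move=> hx hy; have [n [w [p [q [wP -> ->]]]]] := cyclotomic_common_root hx hy.
by exists n, w, (p * q); rewrite rmorphM hornerM.
Qed.

Lemma cyclotomic_int (a : int) : cyclotomic_number (a%:~R : C).
Proof. by rewrite -ratr_int; apply: cyclotomic_ratr. Qed.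

Lemma cyclotomic_nat (n : nat) : cyclotomic_number (n%:R : C).
Proof. exact: (cyclotomic_int n). Qed.

Lemma cyclotomicN x : cyclotomic_number x -> cyclotomic_number (- x).
Proof.
by rewrite -mulN1r; apply: cyclotomicM; apply: (cyclotomic_int (-1)).
Qed.

Lemma cyclotomicX n x : cyclotomic_number x -> cyclotomic_number (x ^+ n).
Proof.
move=> hx; elim: n => [|n IHn]; first exact: (cyclotomic_nat 1).
by rewrite exprS; apply: cyclotomicM.
Qed.

Lemma cyclotomic_sum (I : Type) (r : seq I) (P : pred I) (F : I -> C) :
  (forall i, P i -> cyclotomic_number (F i)) ->
  cyclotomic_number (\sum_(i <- r | P i) F i).
Proof.
move=> h; elim/big_rec: _ => [|i x Pi hx]; first exact: (cyclotomic_nat 0).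
by apply: cyclotomicD => //; exact: h.
Qed.

(** Two [n]-th roots of the same nonzero number differ by a root of unity, so exhibiting one
    cyclotomic root is enough. *)
Lemma cyclotomic_exp_eq n x y :
  (0 < n)%N -> cyclotomic_number y -> y ^+ n = x ^+ n -> cyclotomic_number x.
Proof.
move=> n_gt0 hy yx; have [y0|y0] := eqVneq y 0.
  move: yx; rewrite y0 expr0n gtn_eqF // => /esym/eqP.
  by rewrite expf_eq0 n_gt0 /= => /eqP->; exact: (cyclotomic_nat 0).
rewrite -[x](divfK y0); apply: cyclotomicM => //.
apply: (cyclotomic_unity_root n_gt0).
by rewrite expr_div_n yx divff // -yx expf_neq0.
Qed.

End CyclotomicNumbers.

(** * Gauss and Jacobi sums over ['F_p] *)

Lemma Fp_exp_pred p (x : 'F_p) : prime p -> x != 0 -> x ^+ p.-1 = 1.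
Proof.
move=> p_prime x0; have := expf_card x.
rewrite card_Fp // -[X in x ^+ X = x](prednK (prime_gt0 p_prime)) exprS.
by move=> /(canRL (mulKf x0)) ->; rewrite mulVf.
Qed.

Section GaussSums.

Variables (C : numClosedFieldType) (p : nat) (g : 'F_p) (zeta : C).
Hypotheses (p_prime : prime p) (gP : (p.-1).-primitive_root g)
  (zetaP : p.-primitive_root zeta).
Implicit Types (w : C) (x y : 'F_p).

Let p1_gt0 : (0 < p.-1)%N. Proof. exact: prim_order_gt0 gP. Qed.

Definition add_char x : C := zeta ^+ x.

Lemma add_char0 : add_char 0 = 1. Proof. exact: expr0. Qed.

Lemma add_charD x y : add_char (x + y) = add_char x * add_char y.
Proof.
rewrite /add_char -exprD /= -[in RHS](prim_expr_mod zetaP).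
by congr (_ ^+ (_ %% _)); apply: Fp_cast.
Qed.

Lemma add_char_eq1 x : (add_char x == 1) = (x == 0).
Proof.
rewrite /add_char -(prim_order_dvd zetaP) /dvdn modn_small //.
by rewrite -[X in (_ < X)%N](Fp_cast p_prime) ltn_ord.
Qed.

Lemma sum_add_char x : \sum_y add_char (y * x) = if x == 0 then p%:R else 0.
Proof.
have [->|x0] := eqVneq.
  under eq_bigr do rewrite mulr0 add_char0.
  by rewrite sumr_const card_Fp.
set S := \sum_y _; have : add_char x * S = S.
  rewrite mulr_sumr [RHS](reindex_inj (addrI 1)); apply: eq_bigr => y _.
  by rewrite -add_charD mulrDl mul1r.
move/eqP; rewrite -subr_eq0 -[X in _ - X]mul1r -mulrBl mulf_eq0 subr_eq0.
by rewrite add_char_eq1 (negPf x0) => /eqP.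
Qed.

(* The junk value at [x = 0] is irrelevant: [mul_char] vanishes there. *)
Definition dlog x : nat := odflt ord0 [pick i : 'I_p.-1.+1 | x == g ^+ i].

Lemma dlogK x : x != 0 -> g ^+ dlog x = x.
Proof.
move=> x0; rewrite /dlog; case: pickP => [i /eqP//|noi].
have [|i Di] := prim_rootP gP (x := x).
  exact: Fp_exp_pred.
by have := noi (widen_ord (leqnSn _) i); rewrite /= -Di eqxx.
Qed.

(** When [w ^+ p.-1 = 1], this is the multiplicative character sending the generator [g] to [w].
    With [w] as parameter, products and inverses of characters become operations on [w]. *)
Definition mul_char w x : C := if x == 0 then 0 else w ^+ dlog x.

Lemma mul_char0 w : mul_char w 0 = 0. Proof. by rewrite /mul_char eqxx. Qed.

Lemma g_neq0 : g != 0.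
Proof.
apply/eqP=> g0; have /eqP := prim_expr_order gP.
by rewrite g0 expr0n gtn_eqF // eq_sym oner_eq0.
Qed.

Lemma mul_char_gX w i : w ^+ p.-1 = 1 -> mul_char w (g ^+ i) = w ^+ i.
Proof.
move=> w1; rewrite /mul_char expf_eq0 (negPf g_neq0) andbF.
have /eqP := dlogK (expf_neq0 i g_neq0).
rewrite (eq_prim_root_expr gP) => /eqP eq_i.
by rewrite -(expr_mod _ w1) eq_i expr_mod.
Qed.

Lemma mul_charM w x y : w ^+ p.-1 = 1 ->
  mul_char w (x * y) = mul_char w x * mul_char w y.
Proof.
move=> w1; have [->|x0] := eqVneq x 0; first by rewrite mul0r mul_char0 mul0r.
have [->|y0] := eqVneq y 0; first by rewrite mulr0 mul_char0 mulr0.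
by rewrite -(dlogK x0) -(dlogK y0) -exprD !mul_char_gX // exprD.
Qed.

Lemma mul_char1 w : w ^+ p.-1 = 1 -> mul_char w 1 = 1.
Proof. by move=> w1; rewrite -(expr0 g) mul_char_gX. Qed.

Lemma mul_char_mul w w' x : mul_char w x * mul_char w' x = mul_char (w * w') x.
Proof. by rewrite /mul_char; case: ifP => _; rewrite ?mul0r // exprMn. Qed.

Lemma sum_mul_char w : w ^+ p.-1 = 1 -> w != 1 -> \sum_x mul_char w x = 0.
Proof.
move=> w1 wn1; set S := \sum_x _; have : w * S = S.
  rewrite mulr_sumr [RHS](reindex_inj (mulfI g_neq0)); apply: eq_bigr => y _.
  by rewrite mul_charM // -[in mul_char w g](expr1 g) mul_char_gX // expr1.
move/eqP; rewrite -subr_eq0 -[X in _ - X]mul1r -mulrBl mulf_eq0 subr_eq0.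
by rewrite (negPf wn1) => /eqP.
Qed.

Definition gauss_sum w := \sum_x mul_char w x * add_char x.

Definition jacobi_sum w := \sum_x mul_char w x * mul_char w (1 - x).

(** Substituting [y * x] for [x] leaves [mul_char w x * add_char (y * (1 + x))]. The sum over
    nonzero [y] is [p - 1] at [x = -1] and [-1] elsewhere, and the contributions of [-1] cancel
    because the character is nontrivial. *)
Lemma gauss_sumV w : w ^+ p.-1 = 1 -> w != 1 ->
  gauss_sum w * gauss_sum w^-1 = mul_char w (-1) * p%:R.
Proof.
move=> w1 wn1; have w0 : w != 0.
  by apply: contra_eq_neq w1 => ->; rewrite expr0n gtn_eqF // eq_sym oner_neq0.
have wV1 : w^-1 ^+ p.-1 = 1 by rewrite exprVn w1 invr1.
transitivity (\sum_x \sum_(y | y != 0) mul_char w x * add_char (y * (1 + x))).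
  rewrite exchange_big mulrC /gauss_sum mulr_suml (bigD1 0) //= mul_char0 !mul0r add0r.
  apply: eq_bigr => y y0; rewrite mulr_sumr (reindex_inj (mulfI y0)).
  apply: eq_bigr => x _; rewrite mul_charM // mulrDr mulr1 add_charD.
  suff yV : mul_char w^-1 y * mul_char w y = 1 by rewrite -[RHS]mul1r -yV; ring.
  by rewrite mul_char_mul mulVf // /mul_char (negPf y0) expr1n.
transitivity (\sum_x mul_char w x * ((if 1 + x == 0 then p%:R else 0) - 1)).
  apply: eq_bigr => x _; rewrite -sum_add_char (bigD1 0 (P := predT)) //=.
  by rewrite mul0r add_char0 addrAC subrr add0r mulr_sumr.
under eq_bigr do rewrite mulrBr mulr1.
rewrite sumrB sum_mul_char // subr0 (bigD1 (-1)) //= subrr eqxx.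
rewrite big1 ?addr0 // => x xn1.
by rewrite addrC addr_eq0 (negPf xn1) mulr0.
Qed.

(** The double sum is sliced along [s = x + y]. For [s != 0], scaling by [s] extracts
    [mul_char (w ^+ 2) s] and leaves the Jacobi sum; the slice [s = 0] is a multiple of the sum of
    the nontrivial character of [w ^+ 2]. *)
Lemma gauss_sum_sqr w : w ^+ p.-1 = 1 -> w ^+ 2 != 1 ->
  gauss_sum w ^+ 2 = jacobi_sum w * gauss_sum (w ^+ 2).
Proof.
move=> w1 wn1.
have w21 : w ^+ 2 ^+ p.-1 = 1 by rewrite -exprM mulnC exprM w1 expr1n.
transitivity (\sum_s \sum_x mul_char w x * mul_char w (s - x) * add_char s).
  rewrite exchange_big expr2 /gauss_sum mulr_suml; apply: eq_bigr => x _.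
  rewrite mulr_sumr [RHS](reindex_inj (addrI x)); apply: eq_bigr => y _ /=.
  by rewrite add_charD addrAC subrr add0r; ring.
rewrite mulr_sumr (bigD1 0) //= [X in X + _](_ : _ = 0) ?add0r; last first.
  rewrite -mulr_suml (eq_bigr (fun x => mul_char w (-1) * mul_char (w ^+ 2) x)).
    by rewrite -mulr_sumr sum_mul_char // mulr0 mul0r.
  by move=> x _; rewrite sub0r -(mulN1r x) mul_charM // expr2 -mul_char_mul; ring.
rewrite [RHS](bigD1 0) //= mul_char0 mul0r mulr0 add0r; apply: eq_bigr => s s0.
rewrite -mulr_suml mulrA; congr (_ * _); rewrite (reindex_inj (mulfI s0)) mulr_suml.
apply: eq_bigr => x _; rewrite -[X in X - _]mulr1 -mulrBr !mul_charM //.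
by rewrite expr2 -mul_char_mul; ring.
Qed.

End GaussSums.

Lemma Fp_primitive_root p : prime p -> exists g : 'F_p, (p.-1).-primitive_root g.
Proof.
move=> p_prime; have p1_gt0 : (0 < p.-1)%N by rewrite -subn1 subn_gt0 prime_gt1.
pose rs := rem 0 (enum 'F_p).
have rs_unity : all (p.-1).-unity_root rs.
  apply/allP=> x; rewrite mem_rem_uniq ?enum_uniq // !inE => /andP[x0 _].
  by rewrite unity_rootE Fp_exp_pred.
have rs_uniq : uniq rs by rewrite rem_uniq ?enum_uniq.
have rs_size : (p.-1 <= size rs)%N by rewrite size_rem ?mem_enum // -cardE card_Fp.
by have /hasP[g _ gP] := has_prim_root p1_gt0 rs_unity rs_uniq rs_size; exists g.
Qed.

(** * Square roots of rational numbers are cyclotomic *)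

Section GaussSumValues.

Variables (C : numClosedFieldType).
Implicit Types (x y z w : C).

Lemma cyclotomic_mul_char p (g x : 'F_p) w :
  cyclotomic_number w -> cyclotomic_number (mul_char g w x).
Proof.
move=> hw; rewrite /mul_char; case: ifP => _; first exact: (cyclotomic_nat _ 0).
exact: cyclotomicX.
Qed.

Lemma cyclotomic_gauss_sum p (g : 'F_p) n w zeta :
  p.-primitive_root zeta -> (0 < n)%N -> w ^+ n = 1 ->
  cyclotomic_number (gauss_sum g zeta w).
Proof.
move=> zetaP n_gt0 w1; apply: cyclotomic_sum => x _; apply: cyclotomicM.
  by apply/cyclotomic_mul_char/(cyclotomic_unity_root n_gt0).
apply/cyclotomicX/(cyclotomic_unity_root (prim_order_gt0 zetaP)).
exact: prim_expr_order.
Qed.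

Lemma cyclotomic_sqrt_prime p x : prime p -> x ^+ 2 = p%:R -> cyclotomic_number x.
Proof.
move=> p_prime; have [->|p_odd] := even_prime p_prime => xp.
  have [w wP] := primitive_root_exists C (isT : 0 < 8)%N.
  have w4 : w ^+ 4 = -1.
    have /eqP : (w ^+ 4) ^+ 2 = 1 by rewrite -exprM prim_expr_order.
    rewrite sqrf_eq1 -(prim_order_dvd wP) /= => /eqP //.
  have hw : cyclotomic_number w.
    by apply: (cyclotomic_unity_root (n := 8)) => //; exact: prim_expr_order.
  (* For an eighth root of unity, [w ^+ 4 = -1] gives [(w - w ^+ 3) ^+ 2 = 2]. *)
  apply: (@cyclotomic_exp_eq _ 2 x (w - w ^+ 3)) => //.
    by apply: cyclotomicD => //; apply/cyclotomicN/cyclotomicX.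
  rewrite xp; transitivity (w ^+ 2 - 2 * w ^+ 4 + w ^+ 2 * w ^+ 4); first by ring.
  by rewrite w4; ring.
have [g gP] := Fp_primitive_root p_prime.
have [zeta zetaP] := primitive_root_exists C (prime_gt0 p_prime).
have m1 : (-1 : C) ^+ p.-1 = 1.
  by rewrite -signr_odd -subn1 oddB ?prime_gt0 // p_odd.
have m1n : (-1 : C) != 1 by rewrite eq_sym -subr_eq0 opprK (pnatr_eq0 C 2).
have := gauss_sumV p_prime gP zetaP m1 m1n; rewrite invrN1.
set G := gauss_sum _ _ _; set e := mul_char _ _ _ => GG.
have e2 : e ^+ 2 = 1.
  by rewrite expr2 -mul_charM // mulrNN mulr1 mul_char1.
(* The quadratic Gauss sum satisfies [G ^+ 2 = e * p] with [e] a sign; the factor [sqrtC e], a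
   fourth root of unity, corrects it. *)
apply: (@cyclotomic_exp_eq _ 2 x (G * sqrtC e)) => //.
  apply: cyclotomicM; first 
    by apply: (@cyclotomic_gauss_sum _ _ 2 _ _ zetaP); rewrite // sqrrN expr1n.
  by apply: (@cyclotomic_unity_root _ 4) => //; rewrite (exprM _ 2 2) sqrtCK.
by rewrite exprMn sqrtCK expr2 GG xp mulrAC -expr2 e2 mul1r.
Qed.

Lemma cyclotomic_sqrt_nat n x : x ^+ 2 = n%:R -> cyclotomic_number x.
Proof.
elim/ltn_ind: n x => n IHn x xn.
have [n1|n1] := leqP n 1.
  apply: (@cyclotomic_exp_eq _ 2 x n%:R) => //.
    exact: cyclotomic_nat.
  by rewrite xn; case: n n1 {IHn xn} => [|[|]] // _; rewrite ?expr0n ?expr1n.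
have p_prime := pdiv_prime n1; set p := pdiv n in p_prime.
have p0 : (p%:R : C) != 0 by rewrite pnatr_eq0 -lt0n prime_gt0.
apply: (@cyclotomic_exp_eq _ 2 x (sqrtC p%:R * sqrtC (n %/ p)%:R)) => //.
  apply: cyclotomicM; first exact: (cyclotomic_sqrt_prime p_prime (sqrtCK _)).
  by apply: (IHn (n %/ p)%N); rewrite ?sqrtCK // ltn_Pdiv ?prime_gt1 // ltnW.
by rewrite exprMn !sqrtCK xn -natrM mulnC divnK ?pdiv_dvd.
Qed.

Lemma cyclotomic_sqrt_rat (a : rat) x : x ^+ 2 = ratr a -> cyclotomic_number x.
Proof.
move=> xa; have d0 : (denq a)%:~R != 0 :> C by rewrite intr_eq0 denq_neq0.
rewrite -[x](mulKf d0); apply: cyclotomicM.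
  by rewrite -ratr_int -fmorphV; apply: cyclotomic_ratr.
have xd : ((denq a)%:~R * x) ^+ 2 = (numq a * denq a)%:~R.
  by rewrite exprMn xa /ratr intrM; field.
set y := _ * x in xd *; case: (numq a * denq a) xd => n yn.
  exact: (@cyclotomic_sqrt_nat n).
(* For a negative radicand, comparing fourth powers absorbs the sign. *)
apply: (@cyclotomic_exp_eq _ 4 y (sqrtC n.+1%:R)) => //.
  exact: (cyclotomic_sqrt_nat (sqrtCK _)).
by rewrite !(exprM _ 2 2) yn sqrtCK NegzE rmorphN sqrrN.
Qed.

End GaussSumValues.

(** * Divisibility in the Eisenstein integers *)

(* The norm of [a + b * w], for [w] a primitive cube root of unity. *)
Definition eis_norm (a b : int) : int := a ^+ 2 - a * b + b ^+ 2.

Lemma eis_norm_ge0 a b : 0 <= eis_norm a b.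
Proof. rewrite /eis_norm; nia. Qed.

Lemma prime_dvdzM p (a b : int) :
  prime p -> (p %| a * b)%Z = (p %| a)%Z || (p %| b)%Z.
Proof. by move=> p_prime; rewrite !dvdzE abszM Euclid_dvdM. Qed.

Lemma prime_dvdz_sqr p (a : int) : prime p -> (p %| a ^+ 2)%Z = (p %| a)%Z.
Proof. by move=> p_prime; rewrite expr2 prime_dvdzM // orbb. Qed.

(** The product of [a + b * w] with the conjugate of [c + d * w] has coefficients
    [a * (c - d) + b * d] and [b * c - a * d]. Its norm is a multiple of [p], so [p] divides the
    first coefficient once it divides the second; both divided by [p] give the quotient. *)
Lemma eis_div p (c d a b : int) : prime p ->
  eis_norm c d = p -> (p %| eis_norm a b)%Z -> (p %| b * c - a * d)%Z ->
  exists a' b', [/\ a = c * a' - d * b', b = c * b' + d * a' - d * b'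
    & eis_norm a b = p%:Z * eis_norm a' b'].
Proof.
move=> p_prime Ncd /dvdzP[m Nab] /dvdzP[v Dv].
have p0 : p%:Z != 0 by rewrite eqz_nat -lt0n prime_gt0.
have /dvdzP[u Du] : (p %| a * (c - d) + b * d)%Z.
  rewrite -prime_dvdz_sqr //; apply/dvdzP.
  exists (m * p%:Z - (a * (c - d) + b * d) * -v - v ^+ 2 * p%:Z).
  set U := a * (c - d) + b * d.
  transitivity (eis_norm a b * eis_norm c d + U * (b * c - a * d)
                - (b * c - a * d) ^+ 2).
    by rewrite /U /eis_norm; ring.
  by rewrite Nab Ncd Dv; ring.
exists u, v; split.
- apply: (mulIf p0); transitivity (c * (u * p%:Z) - d * (v * p%:Z)); last by ring.
  by rewrite -Du -Dv -Ncd /eis_norm; ring.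
- apply: (mulIf p0).
  transitivity (c * (v * p%:Z) + d * (u * p%:Z) - d * (v * p%:Z)); last by ring.
  by rewrite -Du -Dv -Ncd /eis_norm; ring.
apply: (mulIf p0); apply: (mulIf p0).
transitivity
  (p%:Z * ((u * p%:Z) ^+ 2 - (u * p%:Z) * (v * p%:Z) + (v * p%:Z) ^+ 2)).
  by rewrite -Du -Dv -Ncd /eis_norm; ring.
by rewrite /eis_norm; ring.
Qed.

(* The product of the two integers is [b ^+ 2 * eis_norm c d - d ^+ 2 * eis_norm a b];
   they are the obstructions to the division of [a + b * w] by [c + d * w] and
   by its conjugate [(c - d) - d * w]. *)
Lemma eis_split p (c d a b : int) : prime p ->
  eis_norm c d = p -> (p %| eis_norm a b)%Z ->
  (p %| b * c - a * d)%Z || (p %| b * (c - d) - a * - d)%Z.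
Proof.
move=> p_prime Ncd /dvdzP[m Nab]; rewrite -prime_dvdzM //.
apply/dvdzP; exists (b ^+ 2 - d ^+ 2 * m).
transitivity (b ^+ 2 * eis_norm c d - d ^+ 2 * eis_norm a b).
  by rewrite /eis_norm; ring.
by rewrite Ncd Nab; ring.
Qed.

(** A zero with [y != 0] yields [t = - x / y] with [t ^+ 2 + t + 1 = 0], hence [t ^+ 3 = 1]. As the
    order of [F] is 2 modulo 3, [t ^+ #|F| = t] becomes [t ^+ 2 = t], so [t = 1] and 3 vanishes in
    [F]. *)
Lemma finField_eis_norm_eq0 (F : finFieldType) (x y : F) :
  (#|F| %% 3 = 2)%N -> 3%:R != 0 :> F ->
  x ^+ 2 - x * y + y ^+ 2 = 0 -> (x == 0) && (y == 0).
Proof.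
move=> F3 n3 xy0; have [y0|y0] := eqVneq y 0.
  by move/eqP: xy0; rewrite y0 mulr0 subr0 expr0n addr0 expf_eq0 /= andbT.
pose t := - x / y.
have t2 : t ^+ 2 + t + 1 = 0.
  by apply: (mulIf (expf_neq0 2 y0)); rewrite mul0r -xy0 /t; field.
have t3 : t ^+ 3 = 1.
  apply/eqP; rewrite -subr_eq0 (_ : _ - _ = (t - 1) * (t ^+ 2 + t + 1)); last by ring.
  by rewrite t2 mulr0.
have t0 : t != 0.
  by apply: contra_eq_neq t3 => ->; rewrite expr0n eq_sym oner_neq0.
have t1 : t = 1.
  have := expf_card t.
  rewrite (divn_eq #|F| 3) F3 mulnC exprD exprM t3 expr1n mul1r expr2.
  by move=> /(canRL (mulKf t0)); rewrite mulVf.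
by case/eqP: n3; rewrite -t2 t1; ring.
Qed.

Lemma eis_inert p (a b : int) : prime p -> (p %% 3 = 2)%N ->
  (p %| eis_norm a b)%Z -> (p %| a)%Z && (p %| b)%Z.
Proof.
move=> p_prime p3; have pchar_p := pchar_Fp p_prime.
rewrite !(dvdz_pcharf pchar_p) /eis_norm rmorphD rmorphB !rmorphXn rmorphM /= => /eqP.
apply: finField_eis_norm_eq0; rewrite ?card_Fp // -(dvdn_pcharf pchar_p).
by rewrite dvdn_prime2 //; apply: contra_eq_neq p3 => ->.
Qed.

(* Division by [1 + 2 * w], a square root of -3. *)
Lemma eis_ramified (a b : int) : (3 %| eis_norm a b)%Z ->
  exists a' b', [/\ a = a' - 2 * b', b = 2 * a' - b'
    & eis_norm a b = 3 * eis_norm a' b'].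
Proof.
move=> /dvdzP[m Nab].
(* The norm equals [(a + b) ^+ 2 - 3 * a * b]. *)
have : (3%N %| a + b)%Z.
  rewrite -prime_dvdz_sqr //; apply/dvdzP; exists (m + a * b).
  by rewrite mulrDl -Nab /eis_norm; ring.
case/dvdzP=> c Dc; exists (2 * c - a), (c - a).
have -> : b = 3 * c - a by move: Dc; lia.
by split; rewrite ?/eis_norm; ring.
Qed.

(** * Cyclotomic cube roots of Eisenstein integers *)

Section CubeRoots.

Variables (C : numClosedFieldType).
Implicit Types (x y z w : C).

Lemma cube_root_unity_sqrE w : w ^+ 2 + w + 1 = 0 -> w ^+ 2 = - w - 1.
Proof. by move=> ww; apply/eqP; rewrite -subr_eq0 opprD !opprK addrA ww. Qed.

Definition cyclotomic_cube x := exists2 y : C, cyclotomic_number y & y ^+ 3 = x.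

Lemma cyclotomic_cubeM x y :
  cyclotomic_cube x -> cyclotomic_cube y -> cyclotomic_cube (x * y).
Proof.
move=> [u hu <-] [v hv <-]; exists (u * v); first exact: cyclotomicM.
by rewrite exprMn.
Qed.

Definition eis (w : C) (a b : int) : C := a%:~R + b%:~R * w.

Lemma eis_mul w a b c d : w ^+ 2 + w + 1 = 0 ->
  eis w c d * eis w a b = eis w (c * a - d * b) (c * b + d * a - d * b).
Proof.
move=> ww; rewrite /eis !(rmorphD, rmorphB, rmorphM) /=.
transitivity (a%:~R * c%:~R + (a%:~R * d%:~R + b%:~R * c%:~R) * w
              + b%:~R * d%:~R * w ^+ 2); first by ring.
by rewrite (cube_root_unity_sqrE ww); ring.
Qed.

(* [a] and [b] do not depend on the choice of the primitive cube root of unity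
   [w]: conjugation in Z[w] is the passage from [w] to [w ^+ 2]. *)
Definition eis_fun (f : C -> C) :=
  exists a b, forall w, w ^+ 2 + w + 1 = 0 -> f w = eis w a b.

Lemma eis_fun_nat n : eis_fun (fun=> n%:R).
Proof. by exists n%:Z, 0 => w _; rewrite /eis mul0r addr0. Qed.

Lemma eis_funD f h : eis_fun f -> eis_fun h -> eis_fun (fun w => f w + h w).
Proof.
move=> [a [b fE]] [c [d hE]]; exists (a + c), (b + d) => w ww.
by rewrite fE // hE // /eis !rmorphD; ring.
Qed.

Lemma eis_funM f h : eis_fun f -> eis_fun h -> eis_fun (fun w => f w * h w).
Proof.
move=> [a [b fE]] [c [d hE]]; exists (a * c - b * d), (a * d + b * c - b * d).
by move=> w ww; rewrite fE // hE // eis_mul.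
Qed.

Lemma eis_fun_mul_char p (g x : 'F_p) : eis_fun (fun w => mul_char g w x).
Proof.
rewrite /mul_char; case: (x == 0); first exact: (eis_fun_nat 0).
elim: (dlog g x) => [|n IHn]; first by exists 1, 0 => w _; rewrite /eis mul0r addr0.
have [|a [b h]] := @eis_funM (fun w => w) _ _ IHn.
  by exists 0, 1 => w _; rewrite /eis mul1r add0r.
by exists a, b => w /h <-; rewrite exprS.
Qed.

(** The Jacobi sums at [w] and [w ^+ 2] thus have the same integer coefficients: they are conjugate
    in Z[w]. *)
Lemma eis_fun_jacobi_sum p (g : 'F_p) : eis_fun (jacobi_sum g).
Proof.
rewrite /jacobi_sum; elim: (index_enum _) => [|x r IHr].
  by exists 0, 0 => w _; rewrite big_nil /eis mul0r addr0.
have h1 := eis_funM (eis_fun_mul_char g x) (eis_fun_mul_char g (1 - x)).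
have [a [b h]] := eis_funD h1 IHr.
by exists a, b => w /h <-; rewrite big_cons.
Qed.

Lemma cube_root_unity w : w ^+ 2 + w + 1 = 0 -> w ^+ 3 = 1.
Proof.
move=> ww; apply/eqP; rewrite -subr_eq0.
rewrite (_ : _ - _ = (w - 1) * (w ^+ 2 + w + 1)); last by ring.
by rewrite ww mulr0.
Qed.

Lemma cube_root_unity_exists : exists w : C, w ^+ 2 + w + 1 = 0.
Proof.
have [w wP] := primitive_root_exists C (isT : 0 < 3)%N.
have wn1 : w - 1 != 0 by rewrite subr_eq0 -(prim_order_dvd wP 1%N).
exists w; apply: (mulfI wn1); rewrite mulr0.
transitivity (w ^+ 3 - 1); first by ring.
by rewrite (prim_expr_order wP) subrr.
Qed.

Lemma cube_root_unity_sqr w : w ^+ 2 + w + 1 = 0 -> (w ^+ 2) ^+ 2 + w ^+ 2 + 1 = 0.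
Proof.
move=> ww; transitivity ((w ^+ 2 + w + 1) * (w ^+ 2 - w + 1)); first by ring.
by rewrite ww mul0r.
Qed.

Lemma eis_conj_norm w a b : w ^+ 2 + w + 1 = 0 ->
  eis w a b * eis (w ^+ 2) a b = (eis_norm a b)%:~R.
Proof.
move=> ww; rewrite /eis /eis_norm rmorphD rmorphB !rmorphXn rmorphM /=.
have w3 := cube_root_unity ww.
have w2 : w ^+ 2 = - w - 1 := cube_root_unity_sqrE ww.
transitivity (a%:~R ^+ 2 + a%:~R * b%:~R * (w + w ^+ 2) + b%:~R ^+ 2 * w ^+ 3 : C).
  by ring.
by rewrite w3 w2; ring.
Qed.

(** Here [c + d * w] is the cubic Jacobi sum, and the Gauss sum [G w] is the required cube root. *)
Lemma eis_split_prime p : prime p -> (p %% 3 = 1)%N -> exists c d,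
  eis_norm c d = p /\
  forall w, w ^+ 2 + w + 1 = 0 -> cyclotomic_cube (p%:R * eis w c d).
Proof.
move=> p_prime p3; have p_gt0 := prime_gt0 p_prime.
have [g gP] := Fp_primitive_root p_prime.
have [zeta zetaP] := primitive_root_exists C p_gt0.
have [c [d Jcd]] := eis_fun_jacobi_sum g.
pose G := gauss_sum g zeta.
have p0 : (p%:R : C) != 0 by rewrite pnatr_eq0 -lt0n.
have n3 : (1 + 1 + 1 : C) != 0 by rewrite (_ : _ + _ = 3%:R) ?pnatr_eq0 //; ring.
have w_facts w : w ^+ 2 + w + 1 = 0 ->
    [/\ w ^+ 3 = 1, w ^+ p.-1 = 1, w != 1 & w ^+ 2 != 1].
  move=> ww; have w3 := cube_root_unity ww; split=> //.
  - have -> : p.-1 = (3 * (p %/ 3))%N by rewrite [in LHS](divn_eq p 3) p3 addn1 mulnC.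
    by rewrite exprM w3 expr1n.
  - by apply/eqP=> w1; move/eqP: ww; rewrite w1 expr1n (negPf n3).
  apply/eqP=> w1; move: w3; rewrite exprS w1 mulr1 => w1'.
  by move/eqP: ww; rewrite w1' expr1n (negPf n3).
have GG w : w ^+ 2 + w + 1 = 0 -> G w * G (w ^+ 2) = p%:R.
  move=> ww; have [w3 w1 wn1 _] := w_facts w ww.
  have w0 : w != 0 by apply: contra_eq_neq w3 => ->; rewrite expr0n eq_sym oner_neq0.
  have wV : w^-1 = w ^+ 2 by rewrite -[LHS]mul1r -w3 exprSr mulfK.
  have := gauss_sumV p_prime gP zetaP w1 wn1; rewrite wV => ->.
  set e := mul_char _ _ _.
  have e2 : e ^+ 2 = 1 by rewrite expr2 -mul_charM // mulrNN mulr1 mul_char1.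
  (* A value of a cubic character at [-1] has both square and cube equal to 1, so it is 1. *)
  have e3 : e ^+ 3 = 1.
    by rewrite /e /mul_char oppr_eq0 oner_eq0 -exprM mulnC exprM w3 expr1n.
  by rewrite -[e]mulr1 -[in e * _]e2 -exprS e3 mul1r.
have G3 w : w ^+ 2 + w + 1 = 0 -> G w ^+ 3 = p%:R * eis w c d.
  move=> ww; have [_ w1 _ w2n1] := w_facts w ww.
  rewrite exprSr (gauss_sum_sqr p_prime gP zetaP) // Jcd // -mulrA.
  by rewrite [X in _ * X]mulrC GG // mulrC.
exists c, d; split.
  have [w ww] := cube_root_unity_exists.
  apply/eqP; rewrite -(eqr_int C) -(eis_conj_norm _ _ ww) -[p%:~R]/(p%:R).
  (* Multiplying the cube formulas at [w] and [w ^+ 2] gives [p ^+ 2] times the norm on one side and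
     [p ^+ 3] on the other. *)
  rewrite -(inj_eq (mulfI (expf_neq0 2 p0))); apply/eqP.
  transitivity ((p%:R * eis w c d) * (p%:R * eis (w ^+ 2) c d)); first by ring.
  rewrite -!G3 ?cube_root_unity_sqr // -exprMn GG //; by ring.
move=> w ww; exists (G w); last exact: G3.
have [w3 _ _ _] := w_facts w ww.
exact: (cyclotomic_gauss_sum g zetaP (isT : 0 < 3)%N).
Qed.

Lemma eis_conj w a b : w ^+ 2 + w + 1 = 0 -> eis w (a - b) (- b) = eis (w ^+ 2) a b.
Proof.
move=> ww; have w2 : w ^+ 2 = - w - 1 := cube_root_unity_sqrE ww.
by rewrite /eis rmorphB rmorphN /= w2; ring.
Qed.

(** The prime [p] is the product of [c + d * w] and its conjugate, and one of these divides any
    element whose norm is a multiple of [p]; [s] records which. *)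
Lemma eis_peel w p c d a b : w ^+ 2 + w + 1 = 0 -> prime p ->
  eis_norm c d = p -> (p %| eis_norm a b)%Z ->
  exists (s : bool) a' b', eis_norm a b = p%:Z * eis_norm a' b' /\
    eis w a b = (if s then eis w c d else eis (w ^+ 2) c d) * eis w a' b'.
Proof.
move=> ww p_prime Ncd dvN; have Ncd' : eis_norm (c - d) (- d) = p.
  by rewrite -Ncd /eis_norm; ring.
case/orP: (eis_split p_prime Ncd dvN) => dv.
  have [a' [b' [-> Db NN]]] := eis_div p_prime Ncd dvN dv.
  by exists true, a', b'; rewrite eis_mul // -Db.
have [a' [b' [-> Db NN]]] := eis_div p_prime Ncd' dvN dv.
by exists false, a', b'; rewrite -eis_conj // eis_mul // -Db.
Qed.

(** Strong induction on [n]: units for [n = 1]; otherwise a prime factor [p] of [n] is removed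
    according to its behaviour in Z[w], ramified, split or inert. *)
Lemma eis_cube_root w n a b : w ^+ 2 + w + 1 = 0 ->
  eis_norm a b = n%:Z ^+ 3 -> cyclotomic_cube (eis w a b).
Proof.
move=> ww; have w3 := cube_root_unity ww.
have hw : cyclotomic_number w := cyclotomic_unity_root (isT : 0 < 3)%N w3.
have cubeX : forall x, cyclotomic_number x -> cyclotomic_cube (x ^+ 3).
  by move=> x hx; exists x.
have heis c d : cyclotomic_number (eis w c d).
  by apply: cyclotomicD; [|apply: cyclotomicM => //]; exact: cyclotomic_int.
elim/ltn_ind: n a b => n IHn a b Nab.
have [n0|n1] := posnP n.
  have [-> ->] : a = 0 /\ b = 0.
    by move: Nab; rewrite n0 /eis_norm; nia.
  by exists 0; [exact: (cyclotomic_nat _ 0) | rewrite /eis expr0n mul0r addr0].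
have [n_eq|n_gt1] := eqVneq n 1%N.
  have hu : cyclotomic_cube w.
    exists (3.-root w); last by rewrite rootCK.
    by apply: (@cyclotomic_unity_root _ 9) => //; rewrite (exprM _ 3 3) rootCK.
  have h1 : cyclotomic_cube (1 : C).
    by exists 1; [exact: (cyclotomic_nat _ 1) | rewrite expr1n].
  have hm1 : cyclotomic_cube (-1 : C).
    by exists (-1); [exact: (cyclotomic_int _ (-1)) | ring].
  (* The elements of norm 1 are the six units, signs times powers of [w]. *)
  have [e e2 [i ->]] : exists2 e, e ^+ 2 = 1 :> C &
      exists i : nat, eis w a b = e * w ^+ i.
    have m12 : (-1 : C) ^+ 2 = 1 by rewrite sqrrN expr1n.
    have p12 : (1 : C) ^+ 2 = 1 by rewrite expr1n.
    have w2 : w ^+ 2 = - w - 1 := cube_root_unity_sqrE ww.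
    have : [\/ a = 1 /\ b = 0, a = -1 /\ b = 0, a = 0 /\ b = 1 | 
            [\/ a = 0 /\ b = -1, a = 1 /\ b = 1 | a = -1 /\ b = -1]].
      move: Nab; rewrite n_eq /eis_norm => Nab.
      (* Four times the norm is [(a - 2 * b) ^+ 2 + 3 * a ^+ 2], and symmetrically in [b]. *)
      have ha : (a == -1) || (a == 0) || (a == 1).
        have : a ^+ 2 <= 1 by have : 0 <= (a - 2 * b) ^+ 2 by [exact: sqr_ge0]; lia.
        nia.
      have hb : (b == -1) || (b == 0) || (b == 1).
        have : b ^+ 2 <= 1 by have : 0 <= (b - 2 * a) ^+ 2 by [exact: sqr_ge0]; lia.
        nia.
      move: Nab; case/orP: ha => [/orP[]|] /eqP->;
        case/orP: hb => [/orP[]|] /eqP-> //= _;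
        do ?[by constructor; constructor | by constructor; constructor; constructor].
    rewrite /eis; case=> [[-> ->]|[-> ->]|[-> ->]|[[-> ->]|[-> ->]|[-> ->]]].
    - by exists 1 => //; exists 0%N; ring.
    - by exists (-1) => //; exists 0%N; ring.
    - by exists 1 => //; exists 1%N; ring.
    - by exists (-1) => //; exists 1%N; ring.
    - by exists (-1) => //; exists 2%N; rewrite w2; ring.
    - by exists 1 => //; exists 2%N; rewrite w2; ring.
  apply: cyclotomic_cubeM; last first.
    by elim: i => [|i IHi] //; rewrite exprS; exact: cyclotomic_cubeM.
  by move/eqP: e2; rewrite sqrf_eq1 => /orP[] /eqP->.
have {}n_gt1 : (1 < n)%N by lia.
have p_prime := pdiv_prime n_gt1; have p_dv := pdiv_dvd n.
set p := pdiv n in p_prime p_dv.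
have p_gt1 := prime_gt1 p_prime.
case/dvdnP: p_dv => k Dn; have k_gt0 : (0 < k)%N by lia.
have k_lt : (k < n)%N by nia.
have p0 : p%:Z != 0 by lia.
have : (p %% 3 < 3)%N by rewrite ltn_mod.
case p3: (p %% 3)%N => [|[|[|//]]] _.
(* Ramified case: the norm is divisible by 27, so [1 + 2 * w] can be divided out three times, and
   its cube is split off. *)
- have pE : p = 3%N.
    by apply/eqP; rewrite eq_sym -dvdn_prime2 // /dvdn p3.
  have N1 : eis_norm a b = 3 * (9 * k%:Z ^+ 3) by rewrite Nab Dn pE PoszM; ring.
  have [|a1 [b1 [Ea Eb Na]]] := @eis_ramified a b.
    by rewrite N1 dvdz_mulr.
  have N2 : eis_norm a1 b1 = 3 * (3 * k%:Z ^+ 3) by lia.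
  have [|a2 [b2 [Ea1 Eb1 Na1]]] := @eis_ramified a1 b1.
    by rewrite N2 dvdz_mulr.
  have N3 : eis_norm a2 b2 = 3 * k%:Z ^+ 3 by lia.
  have [|a3 [b3 [Ea2 Eb2 Na2]]] := @eis_ramified a2 b2.
    by rewrite N3 dvdz_mulr.
  have mul12 u v : eis w (u - 2 * v) (2 * u - v) = eis w 1 2 * eis w u v.
    by rewrite eis_mul //; congr eis; ring.
  rewrite Ea Eb mul12 Ea1 Eb1 mul12 Ea2 Eb2 mul12.
  rewrite (_ : _ * _ = eis w 1 2 ^+ 3 * eis w a3 b3); last by ring.
  apply: cyclotomic_cubeM; first exact: cubeX.
  by apply: (IHn k k_lt); lia.
(* Split case: three peelings give a product of three factors, each equal to [u = c + d * w] or its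
   conjugate [v]. The products [u ^+ 3] and [v ^+ 3] are visibly cubes; the mixed ones are [p * u]
   and [p * v], cubes of Gauss sums since [u * v = p]. *)
- have [c [d [Ncd cubes]]] := eis_split_prime p_prime p3.
  have K1 := cubes w ww; have K2 := cubes _ (cube_root_unity_sqr ww).
  have KK := eis_conj_norm c d ww; rewrite Ncd -[p%:~R]/(p%:R : C) in KK.
  have peel := eis_peel ww p_prime Ncd.
  have N0 : eis_norm a b = p%:Z * (p%:Z * (p%:Z * k%:Z ^+ 3)).
    by rewrite Nab Dn PoszM; ring.
  have [|s1 [a1 [b1 [Na ->]]]] := peel a b; first by rewrite N0 dvdz_mulr.
  have N1 : eis_norm a1 b1 = p%:Z * (p%:Z * k%:Z ^+ 3).
    by apply: (mulfI p0); rewrite -Na.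
  have [|s2 [a2 [b2 [Na1 ->]]]] := peel a1 b1; first by rewrite N1 dvdz_mulr.
  have N2 : eis_norm a2 b2 = p%:Z * k%:Z ^+ 3.
    by apply: (mulfI p0); rewrite -Na1.
  have [|s3 [a3 [b3 [Na2 ->]]]] := peel a2 b2; first by rewrite N2 dvdz_mulr.
  have N3 : eis_norm a3 b3 = k%:Z ^+ 3.
    by apply: (mulfI p0); rewrite -Na2.
  have {IHn} h := IHn k k_lt _ _ N3.
  rewrite !mulrA; apply: cyclotomic_cubeM => //.
  have E1 : cyclotomic_cube (eis w c d ^+ 3) by apply: cubeX.
  have E2 : cyclotomic_cube (eis (w ^+ 2) c d ^+ 3).
    by rewrite -eis_conj //; apply: cubeX.
  move: K1 K2 E1 E2; rewrite -KK.
  set u := eis w c d; set v := eis (w ^+ 2) c d.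
  rewrite (_ : u * v * u = u * u * v); last by ring.
  move=> K1 K2 E1 E2; case: s1; case: s2; case: s3.
  + by move: E1; rewrite !exprSr expr0 mul1r.
  + by [].
  + by rewrite mulrAC.
  + by [].
  + by rewrite (mulrC v) mulrAC.
  + by rewrite (mulrC v).
  + by rewrite mulrC mulrA.
  + by move: E2; rewrite !exprSr expr0 mul1r.
(* Inert case: [p] divides both coefficients and its square leaves the norm. After two divisions the
   relation between norms forces [p] to divide [k], which permits a third, so that [p ^+ 3] is split
   off and the induction resumes at [l = k / p]. *)
have inert := eis_inert p_prime p3.
have N0 : eis_norm a b = p%:Z * (p%:Z ^+ 2 * k%:Z ^+ 3) by rewrite Nab Dn PoszM; ring.
have /andP[/dvdzP[a1 Ea] /dvdzP[b1 Eb]] : (p %| a)%Z && (p %| b)%Z.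
  by apply: inert; rewrite N0 dvdz_mulr.
have N1 : eis_norm a1 b1 = p%:Z * k%:Z ^+ 3.
  apply: (mulfI (expf_neq0 2 p0)); transitivity (eis_norm a b).
    by rewrite Ea Eb /eis_norm; ring.
  by rewrite N0; ring.
have /andP[/dvdzP[a2 Ea1] /dvdzP[b2 Eb1]] : (p %| a1)%Z && (p %| b1)%Z.
  by apply: inert; rewrite N1 dvdz_mulr.
have N2 : p%:Z * eis_norm a2 b2 = k%:Z ^+ 3.
  apply: (mulfI p0); rewrite -N1 Ea1 Eb1 /eis_norm; ring.
have /dvdzP[l El] : (p %| k%:Z)%Z.
  have : (p %| k%:Z ^+ 3)%Z by rewrite -N2 dvdz_mulr.
  by rewrite !exprS expr0 mulr1 !prime_dvdzM // !orbb.
have N3 : eis_norm a2 b2 = p%:Z ^+ 2 * l ^+ 3.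
  by apply: (mulfI p0); rewrite N2 El; ring.
have /andP[/dvdzP[a3 Ea2] /dvdzP[b3 Eb2]] : (p %| a2)%Z && (p %| b2)%Z.
  by apply: inert; rewrite N3 exprS -mulrA dvdz_mulr.
have N4 : eis_norm a3 b3 = l ^+ 3.
  apply: (mulfI (expf_neq0 2 p0)); rewrite -N3 Ea2 Eb2 /eis_norm; ring.
have -> : eis w a b = p%:R ^+ 3 * eis w a3 b3.
  rewrite Ea Eb Ea1 Eb1 Ea2 Eb2 /eis !rmorphM /= -[p%:~R]/(p%:R : C); ring.
apply: cyclotomic_cubeM; first exact/cubeX/cyclotomic_nat.
have l_ge0 : 0 <= l.
  by rewrite -(@pmulr_lge0 _ p%:Z) -?El // ltz_nat prime_gt0.
case: l El {N3} N4 l_ge0 => // l El N4 _; apply: (IHn l) => //.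
have {}El : k = (l * p)%N by apply/eqP; rewrite -eqz_nat El PoszM.
by apply: leq_ltn_trans k_lt; rewrite El leq_pmulr // prime_gt0.
Qed.

End CubeRoots.

(** * Lagrange resolvents and cubic numbers *)

Section CubicNumbers.

Variables (C : numClosedFieldType).
Implicit Types (x y z w : C).

(** Denominators are cleared by the cube [D ^+ 3], which multiplies the norm by [D ^+ 6] and
    therefore keeps it a cube. *)
Lemma rat_eis_cube_root w (u v s : rat) : w ^+ 2 + w + 1 = 0 ->
  u ^+ 2 - u * v + v ^+ 2 = s ^+ 3 -> cyclotomic_cube (ratr u + ratr v * w).
Proof.
move=> ww uvs; pose D := denq u * denq v * denq s.
pose nu := numq u * denq v * denq s * D ^+ 2.
pose nv := numq v * denq u * denq s * D ^+ 2.
pose ns := numq s * denq u * denq v * D.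
have D0C : (D%:~R : C) != 0 by rewrite intr_eq0 !mulf_neq0 ?denq_neq0.
have dE (q : rat) : (numq q)%:~R = q * (denq q)%:~R :> rat.
  by rewrite -{2}(divq_num_den q) divfK // intr_eq0 denq_neq0.
have Enu : nu%:~R = u * D%:~R ^+ 3 :> rat.
  by rewrite /nu /D !(rmorphM, rmorphXn) /= dE; ring.
have Env : nv%:~R = v * D%:~R ^+ 3 :> rat.
  by rewrite /nv /D !(rmorphM, rmorphXn) /= dE; ring.
have Ens : ns%:~R = s * D%:~R ^+ 2 :> rat.
  by rewrite /ns /D !(rmorphM, rmorphXn) /= dE; ring.
clearbody nu nv ns; have N : eis_norm nu nv = ns ^+ 3.
  apply/eqP; rewrite -(eqr_int rat) /eis_norm.
  rewrite rmorphD rmorphB !rmorphXn rmorphM /= Enu Env Ens.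
  rewrite [X in _ == X](_ : _ = s ^+ 3 * D%:~R ^+ 6); last by ring.
  by rewrite -uvs; apply/eqP; ring.
have ns_ge0 : 0 <= ns.
  by have := eis_norm_ge0 nu nv; rewrite N exprn_odd_ge0.
have [n En] : exists n : nat, ns = n by exists `|ns|%N; rewrite gez0_abs.
rewrite En in N; have [y hy yE] := eis_cube_root ww N.
exists (y * (D%:~R)^-1).
  by apply: cyclotomicM => //; rewrite -ratr_int -fmorphV; exact: cyclotomic_ratr.
have D3 : (D%:~R : C) ^+ 3 != 0 by rewrite expf_neq0.
rewrite exprMn yE exprVn; apply: (mulIf D3); rewrite divfK // /eis.
have := congr1 (@ratr C) Enu; have := congr1 (@ratr C) Env.
rewrite !(rmorphM, rmorphXn) /= !ratr_int => -> ->; by ring.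
Qed.

Lemma cubic_resolvent_cyclotomic w x1 x2 x3 (e1 e2 e3 D : rat) :
  w ^+ 2 + w + 1 = 0 ->
  x1 + x2 + x3 = ratr e1 -> x1 * x2 + x2 * x3 + x3 * x1 = ratr e2 ->
  x1 * x2 * x3 = ratr e3 -> (x1 - x2) * (x2 - x3) * (x3 - x1) = ratr D ->
  cyclotomic_number (x1 + w * x2 + w ^+ 2 * x3).
Proof.
move=> ww E1 E2 E3 ED.
(* [sp] and [sm] are the two cyclic sums of terms [x_i ^+ 2 * x_j]: symmetric functions give their
   sum, and [D] is [sm - sp]. *)
pose sp := (e1 * e2 - 3 * e3 - D) / 2; pose sm := (e1 * e2 - 3 * e3 + D) / 2.
(* The cube of the resolvent is [u + v * w]; [s] is the product of the resolvents for [w] and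
   [w ^+ 2], whence the norm [s ^+ 3]. *)
pose u := e1 ^+ 3 - 3 * (sp + sm) - 3 * sm; pose v := 3 * sp - 3 * sm.
pose s := e1 ^+ 2 - 3 * e2.
have r2 : (2 : C) != 0 by rewrite pnatr_eq0.
have w3 := cube_root_unity ww.
have w2 : w ^+ 2 = - w - 1 := cube_root_unity_sqrE ww.
have Esp : ratr sp = x1 ^+ 2 * x2 + x2 ^+ 2 * x3 + x3 ^+ 2 * x1.
  rewrite /sp fmorph_div !(rmorphB, rmorphM) /= -E1 -E2 -E3 -ED !ratr_nat.
  by field.
have Esm : ratr sm = x1 ^+ 2 * x3 + x2 ^+ 2 * x1 + x3 ^+ 2 * x2.
  rewrite /sm fmorph_div rmorphD !(rmorphB, rmorphM) /= -E1 -E2 -E3 -ED !ratr_nat.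
  by field.
clearbody sp sm; have Es : ratr s = ratr e1 ^+ 2 - 3 * ratr e2 :> C.
  by rewrite /s rmorphB rmorphXn (rmorphM _ 3) rmorph_nat.
have Ev : ratr v = 3 * ratr sp - 3 * ratr sm :> C.
  by rewrite /v rmorphB !rmorphM !rmorph_nat.
have Eu : ratr u = ratr e1 ^+ 3 - 3 * (ratr sp + ratr sm) - 3 * ratr sm :> C.
  by rewrite /u !rmorphB rmorphXn !rmorphM (rmorphD _ sp) !rmorph_nat.
clearbody u v s; have r3E (z : C) : z ^+ 2 = - z - 1 -> z ^+ 3 = 1 ->
    (x1 + z * x2 + z ^+ 2 * x3) ^+ 3 = ratr u + ratr v * z.
  move=> z2 z3; rewrite Eu Ev Esp Esm -E1.
  rewrite z2.
  transitivity ((x1 - x3) ^+ 3 + 3 * (x1 - x3) ^+ 2 * (x2 - x3) * z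
     + 3 * (x1 - x3) * (x2 - x3) ^+ 2 * z ^+ 2 + (x2 - x3) ^+ 3 * z ^+ 3); first by ring.
  by rewrite z2 z3; ring.
have uvs : u ^+ 2 - u * v + v ^+ 2 = s ^+ 3.
  apply: (fmorph_inj (@ratr C)).
  rewrite rmorphD rmorphB !rmorphXn rmorphM /= Eu Ev Esp Esm Es -E1 -E2.
  by ring.
have [y hy yE] := rat_eis_cube_root ww uvs.
by apply: (@cyclotomic_exp_eq _ 3 _ y) => //; rewrite yE r3E.
Qed.

(** Since [1 + w + w ^+ 2 = 0], adding [e1] and the resolvents for [w] and [w ^+ 2] gives
    [3 * x1]. *)
Lemma cubic_cyclotomic x1 x2 x3 (e1 e2 e3 D : rat) :
  x1 + x2 + x3 = ratr e1 -> x1 * x2 + x2 * x3 + x3 * x1 = ratr e2 ->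
  x1 * x2 * x3 = ratr e3 -> (x1 - x2) * (x2 - x3) * (x3 - x1) = ratr D ->
  cyclotomic_number x1.
Proof.
move=> E1 E2 E3 ED; have [w ww] := cube_root_unity_exists C.
have h1 := cubic_resolvent_cyclotomic ww E1 E2 E3 ED.
have h2 := cubic_resolvent_cyclotomic (cube_root_unity_sqr ww) E1 E2 E3 ED.
have w3 := cube_root_unity ww.
have -> : x1 = ratr (1 / 3) * (ratr e1 + ((x1 + w * x2 + w ^+ 2 * x3)
    + (x1 + w ^+ 2 * x2 + (w ^+ 2) ^+ 2 * x3))).
  have r3 : (3 : C) != 0 by rewrite pnatr_eq0.
  rewrite fmorph_div rmorph1 rmorph_nat -E1 -exprM (exprD _ 3 1) w3 mul1r expr1.
  have w2 : w ^+ 2 = - w - 1 := cube_root_unity_sqrE ww.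
  by rewrite w2; field.
apply: cyclotomicM; first exact: cyclotomic_ratr.
by apply: cyclotomicD; [exact: cyclotomic_ratr | exact: cyclotomicD].
Qed.

Lemma quadratic_cyclotomic x (a b : rat) :
  x ^+ 2 + ratr a * x + ratr b = 0 -> cyclotomic_number x.
Proof.
move=> xab; have r2 : (2 : C) != 0 by rewrite pnatr_eq0.
have -> : x = ratr (1 / 2) * ((2 * x + ratr a) + ratr (- a)).
  by rewrite fmorph_div rmorphN rmorph1 rmorph_nat; field.
apply: cyclotomicM; first exact: cyclotomic_ratr.
apply: cyclotomicD; last exact: cyclotomic_ratr.
apply: (@cyclotomic_sqrt_rat _ (a ^+ 2 - 4 * b)).
rewrite rmorphB rmorphXn (rmorphM _ 4) rmorph_nat.
rewrite -[RHS]addr0 -[in RHS](mulr0 4) -xab; ring.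
Qed.

End CubicNumbers.

(** * Characters of a commutative table algebra *)

(** The eigenspace of [M] for [x] is stable under the commuting matrices, whose restrictions to it
    have a common eigenvector. *)
Lemma eigenvalue_common_eigenvector (C : numClosedFieldType) n (M : 'M[C]_n)
    (Ms : seq 'M[C]_n) (x : C) :
  eigenvalue M x -> {in M :: Ms &, forall A B, comm_mx A B} ->
  exists v : 'rV_n, [/\ v != 0, v *m M = x *: v & {in Ms, forall A, stablemx v A}].
Proof.
move=> x_eigen comm; pose E := eigenspace M x.
have stabE A : A \in Ms -> stablemx E A.
  move=> As; apply: comm_mx_stable_eigenspace.
  by apply: comm; rewrite ?mem_head // inE As orbT.
have [||v v0 /allP vP] := @common_eigenvector _ _ [seq conjmx (row_base E) A | A <- Ms].
- by rewrite lt0n mxrank_eq0.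
- move=> _ _ /mapP[A As ->] /mapP[B Bs ->].
  rewrite /comm_mx -!conjmxM ?inE ?stablemx_row_base ?stabE //.
  by rewrite comm // inE ?As ?Bs orbT.
exists (v *m row_base E); split.
- by rewrite mulmx_free_eq0 ?row_base_free.
- by apply/eigenspaceP; rewrite mulmx_sub // eq_row_base.
by move=> A As; rewrite -stablemx_restrict ?stabE // vP // map_f.
Qed.

Section Characters.

Variables (C : numClosedFieldType) (d : nat).
Variables (l : 'I_d.+1 -> 'I_d.+1 -> 'I_d.+1 -> nat) (dl : 'I_d.+1 -> nat).

(** The values on the basis of a unital algebra morphism to [C], written with structure constants
    alone. *)
Definition is_char (f : 'I_d.+1 -> C) : Prop :=
  f ord0 = 1 /\ forall i j, f i * f j = \sum_k (l i j k)%:R * f k.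

Definition rat_regular_mx i : 'M[rat]_d.+1 := \matrix_(k, j) (l i j k)%:R.

(** [lA] says that the regular matrices commute; both sides of [l_dl] are the coefficient of 1 in
    [b_i b_j b_k]. *)
Hypotheses
  (lA : forall i j k t,
    (\sum_s l j t s * l i s k = \sum_s l i t s * l j s k)%N)
  (l1 : forall i k, l i ord0 k = (i == k))
  (l_dl : forall i j k, (l i j k * dl k = l i k j * dl j)%N)
  (dl_gt0 : forall i, (0 < dl i)%N).

(** By [l_dl], multiplication by [b_i] is self-adjoint for the form with weights [1 / dl k], and
    [f], [h] are eigenvectors with distinct eigenvalues [f i], [h i]. *)
Lemma char_orthogonal f h i : is_char f -> is_char h -> f i != h i ->
  \sum_k f k * h k / (dl k)%:R = 0.
Proof.
move=> [_ fM] [_ hM] fh; set S := \sum_k _.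
have dl0 k : ((dl k)%:R : C) != 0 by rewrite pnatr_eq0 -lt0n.
suff : f i * S = h i * S.
  by move/eqP; rewrite -subr_eq0 -mulrBl mulf_eq0 subr_eq0 (negPf fh) => /eqP.
transitivity (\sum_k \sum_j (l i k j)%:R * f j * h k / (dl k)%:R).
  rewrite mulr_sumr; apply: eq_bigr => k _; rewrite !mulrA fM !mulr_suml.
  by [].
rewrite exchange_big mulr_sumr; apply: eq_bigr => j _ /=.
rewrite !mulrA [h i * _]mulrC -[f j * h i * h j]mulrA hM mulr_sumr mulr_suml.
apply: eq_bigr => k _; apply: (mulIf (dl0 k)); rewrite divfK //.
apply: (mulIf (dl0 j)); have := congr1 (fun n => n%:R : C) (l_dl i k j).
rewrite /= !natrM => E; transitivity (f j * h k * ((l i k j)%:R * (dl j)%:R)).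
  by ring.
by rewrite E; field.
Qed.

(** The conjugate of [f] is also a character. Were it different at [i], orthogonality would make a
    sum of nonnegative terms vanish, although its term at [ord0] is positive. *)
Lemma char_real f i : is_char f -> Num.conj (f i) = f i.
Proof.
move=> fP; have cP : is_char (fun i => Num.conj (f i)).
  case: fP => f1 fM; split=> [|j k]; first by rewrite f1 rmorph1.
  rewrite -rmorphM fM rmorph_sum; apply: eq_bigr => t _.
  by rewrite rmorphM rmorph_nat.
apply/eqP; rewrite eq_sym; apply/negP => /negP /(char_orthogonal fP cP) /eqP.
rewrite psumr_eq0 => [/allP /(_ ord0 (mem_index_enum _))|k _].
  by rewrite (proj1 fP) rmorph1 mul1r mul1r invr_eq0 pnatr_eq0 -leqn0 leqNgt dl_gt0.
by rewrite divr_ge0 ?ler0n // mul_conjC_ge0.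
Qed.

(** For a common eigenvector [v], the unit column gives [mu j * v 0 ord0 = v 0 j]: up to scaling,
    [v] is the row of its own eigenvalues, which is a character. *)
Lemma eigenvalue_char i x :
  eigenvalue (map_mx ratr (rat_regular_mx i) : 'M[C]_d.+1) x ->
  exists2 f, is_char f & f i = x.
Proof.
pose M i : 'M[C]_d.+1 := map_mx ratr (rat_regular_mx i).
pose Ms := [seq M j | j in 'I_d.+1].
have MM A B : A \in Ms -> B \in Ms ->
    comm_mx A B.
  move=> /mapP[s _ ->] /mapP[t _ ->]; rewrite /comm_mx; apply/matrixP=> k j.
  rewrite !mxE; have := congr1 (fun n => n%:R : C) (lA s t k j); rewrite /= !natr_sum.
  under eq_bigr do rewrite natrM mulrC.
  under [in X in _ = X -> _]eq_bigr do rewrite natrM mulrC.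
  move=> E; under eq_bigr do rewrite !mxE !ratr_nat.
  by under [RHS]eq_bigr do rewrite !mxE !ratr_nat.
move=> x_eigen.
have [|v [v0 vx vP]] := eigenvalue_common_eigenvector (Ms := Ms) x_eigen.
  move=> A B; rewrite !inE => /orP[/eqP->|?] /orP[/eqP->|?]; apply: MM;
  by rewrite ?image_f.
have vM j : exists mu, v *m M j = mu *: v.
  by have /eigenvectorP[mu /eigenspaceP] := vP (M j) (image_f _ isT); exists mu.
have [mu vmu] := fin_all_exists vM.
have vE j k : mu j * v 0 k = \sum_t (l j k t)%:R * v 0 t.
  have /rowP/(_ k) := vmu j; rewrite !mxE => <-; apply: eq_bigr => t _.
  by rewrite !mxE ratr_nat mulrC.
have vmu0 j : mu j * v 0 ord0 = v 0 j.
  rewrite vE (bigD1 j) //= big1 ?addr0 => [|t tj]; rewrite l1; last first.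
    by rewrite eq_sym (negPf tj) mul0r.
  by rewrite eqxx mul1r.
have v00 : v 0 ord0 != 0.
  apply: contra v0 => /eqP v00; apply/eqP/rowP=> j.
  by rewrite -vmu0 v00 mulr0 mxE.
exists mu; last first.
  apply: (mulIf v00); by have /rowP/(_ ord0) := vx; rewrite -/(M i) vmu !mxE.
split; first by apply: (mulIf v00); rewrite vmu0 mul1r.
move=> j k; apply: (mulIf v00); rewrite -mulrA vmu0 vE mulr_suml.
by apply: eq_bigr => t _; rewrite -mulrA vmu0.
Qed.

Section CharacterTable.

Variables (F : 'I_d.+1 -> 'I_d.+1 -> C) (i0 : 'I_d.+1).
Hypotheses (FP : forall i, is_char (F i)) (F_inj : injective (F^~ i0)).

Let X : 'M[C]_d.+1 := \matrix_(i, k) F i k.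
Let theta i := F i i0.

Lemma char_regular_mx i j k :
  \sum_t F i t * ratr (rat_regular_mx j t k) = F i j * F i k.
Proof.
rewrite (proj2 (FP i)); apply: eq_bigr => t _; rewrite mxE ratr_nat mulrC //.
Qed.

(** Column [t] holds the coordinates of the [t]-th power of the basis element [i0]; multiplied on
    the left by the character table it becomes a Vandermonde matrix. *)
Definition power_mx : 'M[rat]_d.+1 :=
  \matrix_(k, t) (rat_regular_mx i0 ^+ t) k ord0.

Lemma char_power_mx :
  X *m map_mx ratr power_mx = (Vandermonde d.+1 (\row_i theta i))^T.
Proof.
have pow i t s :
    \sum_k F i k * ratr ((rat_regular_mx i0 ^+ t) k s) = theta i ^+ t * F i s.
  elim: t s => [|t IHt] s.
    rewrite !expr0 mul1r (bigD1 s) //= big1 ?addr0 => [|k ks]; rewrite mxE.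
      by rewrite eqxx rmorph1 mulr1.
    by rewrite (negPf ks) rmorph0 mulr0.
  rewrite exprS; under eq_bigr do rewrite mxE rmorph_sum mulr_sumr.
  rewrite exchange_big /= exprS -mulrA -IHt mulr_sumr; apply: eq_bigr => r _.
  rewrite [RHS]mulrA -char_regular_mx mulr_suml; apply: eq_bigr => k _.
  by rewrite rmorphM mulrA.
apply/matrixP=> i t; rewrite !mxE; under eq_bigr do rewrite !mxE.
by rewrite pow (proj1 (FP i)) mulr1.
Qed.

Lemma Vandermonde_theta_neq0 : \det (Vandermonde d.+1 (\row_i theta i)) != 0.
Proof.
rewrite det_Vandermonde; apply/prodf_neq0 => i _; apply/prodf_neq0 => j ij.
rewrite !mxE subr_eq0; apply/eqP => /F_inj ji; by rewrite ji ltnn in ij.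
Qed.

Lemma det_char_table : exists2 c : rat, c != 0 &
  \det (Vandermonde d.+1 (\row_i theta i)) = \det X * ratr c.
Proof.
have E := congr1 determinant char_power_mx.
rewrite det_mulmx det_tr det_map_mx in E; exists (\det power_mx) => //.
by apply: contra_neq Vandermonde_theta_neq0 => c0; rewrite -E c0 rmorph0 mulr0.
Qed.

Lemma char_table_unitmx : X \in unitmx.
Proof.
have [c _ E] := det_char_table; rewrite unitmxE unitfE.
by apply: contra_neq Vandermonde_theta_neq0 => X0; rewrite E X0 mul0r.
Qed.

(** [power_mx] is invertible over the rationals, so each basis element is a rational polynomial in
    the separating one. Galois conjugacy of the [theta i] thereby reaches every column. *)
Lemma char_poly_expr : exists p : 'I_d.+1 -> {poly rat},
  forall i k, F i k = (map_poly ratr (p k)).[theta i].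
Proof.
have [c c0 E] := det_char_table.
have P_unit : power_mx \in unitmx.
  rewrite unitmxE unitfE; have E' := congr1 determinant char_power_mx.
  rewrite det_mulmx det_tr det_map_mx in E'.
  by apply: contra_neq Vandermonde_theta_neq0 => P0; rewrite -E' P0 rmorph0 mulr0.
exists (fun k => \poly_(t < d.+1) invmx power_mx (inord t) k) => i k.
have XE : X = (Vandermonde d.+1 (\row_i theta i))^T *m map_mx ratr (invmx power_mx).
  by rewrite -char_power_mx -mulmxA -map_mxM mulmxV // map_mx1 mulmx1.
have := congr1 (fun M : 'M_d.+1 => M i k) XE; rewrite !mxE => ->.
rewrite (@horner_coef_wide _ d.+1); last by rewrite size_map_poly size_poly.
apply: eq_bigr => t _; rewrite !mxE coef_map coef_poly ltn_ord inord_val.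
by rewrite mulrC.
Qed.

(** The character table diagonalises the regular matrices, whose traces are natural numbers. *)
Lemma char_trace k : \sum_i F i k = (\sum_t l k t t)%N%:R.
Proof.
have XM : X *m map_mx ratr (rat_regular_mx k) = diag_mx (\row_i F i k) *m X.
  apply/matrixP=> i j; rewrite mul_diag_mx !mxE -char_regular_mx.
  by apply: eq_bigr => t _; rewrite !mxE.
have -> : \sum_i F i k = \tr (diag_mx (\row_i F i k)).
  by rewrite mxtrace_diag; apply: eq_bigr => i _; rewrite mxE.
rewrite -[diag_mx _](mulmxK char_table_unitmx) -XM mxtrace_mulC mulmxA.
rewrite mulVmx ?char_table_unitmx // mul1mx natr_sum; apply: eq_bigr => t _.
by rewrite !mxE ratr_nat.
Qed.

Lemma eigenvalue_char_table k x :
  eigenvalue (map_mx ratr (rat_regular_mx k)) x -> exists i, F i k = x.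
Proof.
case/eigenvalueP=> v vx v0.
have XM : X *m map_mx ratr (rat_regular_mx k) = diag_mx (\row_i F i k) *m X.
  apply/matrixP=> i j; rewrite mul_diag_mx !mxE -char_regular_mx.
  by apply: eq_bigr => t _; rewrite !mxE.
pose u := v *m invmx X.
have vE : v = u *m X by rewrite mulmxKV ?char_table_unitmx.
have ux : u *m diag_mx (\row_i F i k) = x *: u.
  rewrite -[LHS](mulmxK char_table_unitmx) -(mulmxA u) -XM mulmxA -vE vx.
  by rewrite -scalemxAl.
have /rV0Pn[i ui] : u != 0 by apply: contra_neq v0 => u0; rewrite vE u0 mul0mx.
exists i; apply: (mulfI ui); have /rowP/(_ i) := ux.
by rewrite mul_mx_diag !mxE => ->; rewrite mulrC.
Qed.

Variable m : 'I_d.+1 -> nat.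
Hypotheses (m_gt0 : forall i, (0 < m i)%N)
  (mP : forall i, \sum_k F i k ^+ 2 / (dl k)%:R = (\sum_k dl k)%N%:R / (m i)%:R).

(** Row orthogonality says [A *m B = 1]; the columns are read off [B *m A = 1]. *)
Lemma char_column_orthogonal j k :
  \sum_i (m i)%:R * F i j * F i k = (\sum_s dl s)%N%:R * (dl j)%:R * (j == k)%:R.
Proof.
set n := (\sum_s dl s)%N.
have dl0 s : ((dl s)%:R : C) != 0 by rewrite pnatr_eq0 -lt0n.
have n0 : (n%:R : C) != 0.
  by rewrite pnatr_eq0 -lt0n /n (bigD1 j) //= addn_gt0 dl_gt0.
have m0 i : ((m i)%:R : C) != 0 by rewrite pnatr_eq0 -lt0n.
pose A : 'M[C]_d.+1 := \matrix_(i, s) ((m i)%:R / n%:R * F i s).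
pose B : 'M[C]_d.+1 := \matrix_(s, i) (F i s / (dl s)%:R).
have AB : A *m B = 1%:M.
  apply/matrixP=> a b; rewrite !mxE.
  transitivity ((m a)%:R / n%:R * \sum_s F a s * F b s / (dl s)%:R).
    by rewrite mulr_sumr; apply: eq_bigr => s _; rewrite !mxE; ring.
  have [->|ab] := eqVneq a b.
    under eq_bigr do rewrite -expr2.
    by rewrite mP -/n mulr1n; field; rewrite n0 m0.
  rewrite (@char_orthogonal _ _ i0) ?mulr0 //.
  by apply: contra_neq ab => /F_inj.
have /matrixP/(_ j k) := mulmx1C AB; rewrite !mxE => <-.
rewrite mulr_sumr; apply: eq_bigr => i _; rewrite !mxE; field.
by rewrite n0 dl0.
Qed.

Lemma det_char_table_sqr :
  \det X ^+ 2 * \prod_i (m i)%:R = (\sum_s dl s)%N%:R ^+ d.+1 * \prod_i (dl i)%:R.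
Proof.
have E : X^T *m (diag_mx (\row_i (m i)%:R) *m X)
    = (\sum_s dl s)%N%:R *: diag_mx (\row_i (dl i)%:R).
  apply/matrixP=> j k; rewrite mul_diag_mx [LHS]mxE [RHS]mxE [X in _ = _ * X]mxE mxE.
  rewrite -[_ *+ (j == k)]mulr_natr mulrA -char_column_orthogonal.
  by apply: eq_bigr => i _; rewrite !mxE; ring.
have := congr1 determinant E; rewrite detZ !det_mulmx det_tr !det_diag.
under eq_bigr do rewrite mxE; under [in X in _ = _ * X -> _]eq_bigr do rewrite mxE.
by move<-; ring.
Qed.

End CharacterTable.
End Characters.

(** * From table algebras to natural structure constants *)

Section TableStructure.

Variables (C : numClosedFieldType) (A : falgType C) (d : nat).
Variables (b : d.+1.-tuple A) (l : 'I_d.+1 -> 'I_d.+1 -> 'I_d.+1 -> nat).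
Hypotheses (b_basis : basis_of fullv b) (b0 : tnth b ord0 = 1)
  (bl : forall i j k, struct_const b i j k = (l i j k)%:R).

Let b_free : free b. Proof. exact: basis_free b_basis. Qed.

Lemma coord_tnth i j : coord b i (tnth b j) = (i == j)%:R.
Proof. by rewrite (tnth_nth 0) coord_free // eq_sym. Qed.

Lemma basis_expansion (x : A) : x = \sum_i coord b i x *: tnth b i.
Proof.
rewrite {1}(coord_basis b_basis (memvf x)); apply: eq_bigr => i _.
by rewrite (tnth_nth 0).
Qed.

Lemma basis_mul i j : tnth b i * tnth b j = \sum_k (l i j k)%:R *: tnth b k.
Proof. by rewrite [LHS]basis_expansion; apply: eq_bigr => k _; rewrite -bl. Qed.

Lemma struct_const1 i k : l i ord0 k = (i == k).
Proof.
apply/eqP; rewrite -(eqr_nat C) -bl /struct_const b0 mulr1 coord_tnth.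
by rewrite [k == i]eq_sym.
Qed.

Lemma struct_constA i j k t :
  (forall x y : A, x * y = y * x) ->
  (\sum_s l j t s * l i s k = \sum_s l i t s * l j s k)%N.
Proof.
move=> mulC; have E (u v : 'I_d.+1) :
    coord b k (tnth b u * (tnth b v * tnth b t)) = (\sum_s l v t s * l u s k)%N%:R.
  rewrite basis_mul mulr_sumr linear_sum natr_sum; apply: eq_bigr => s _ /=.
  by rewrite -scalerAr linearZ /= natrM -(bl u).
apply/eqP; rewrite -(eqr_nat C) -!E.
by rewrite mulrA (mulC (tnth b i)) mulrA.
Qed.

(** Multiplicities are assumed integral for algebra morphisms, so characters given by values must be
    extended linearly. *)
Lemma char_lrmorphism (f : 'I_d.+1 -> C) : is_char l f ->
  exists chi : {lrmorphism A -> C | *%R}, forall j, chi (tnth b j) = f j.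
Proof.
case=> f1 fM; pose chi (x : A) := \sum_j coord b j x * f j.
have chiE j : chi (tnth b j) = f j.
  rewrite /chi (bigD1 j) //= coord_tnth eqxx mul1r big1 ?addr0 // => i ij.
  by rewrite coord_tnth (negPf ij) mul0r.
have chi_lin : linear_for *%R chi.
  move=> a x y; rewrite /chi mulr_sumr -big_split; apply: eq_bigr => j _ /=.
  by rewrite linearP mulrDl mulrA.
pose chiL : {linear A -> C | *%R} :=
  HB.pack chi (GRing.isLinear.Build C A C *%R chi chi_lin).
have chi_mul : monoid_morphism chi.
  split=> [|x y]; first by rewrite -b0 chiE.
  suff : chiL (x * y) = chiL x * chiL y by [].
  rewrite [x]basis_expansion [y]basis_expansion mulr_suml.
  rewrite !linear_sum mulr_suml; apply: eq_bigr => i _.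
  rewrite mulr_sumr linear_sum mulr_sumr; apply: eq_bigr => j _.
  rewrite -scalerAl -scalerAr !linearZ basis_mul linear_sum /= !chiE.
  rewrite [RHS]mulrACA -mulrA fM; congr (_ * (_ * _)); apply: eq_bigr => k _.
  by rewrite -[LHS]/(chiL _) linearZ /= chiE.
pose chiLR : {lrmorphism A -> C | *%R} :=
  HB.pack chi chiL (GRing.isMonoidMorphism.Build A C chi chi_mul).
by exists chiLR.
Qed.

End TableStructure.

Lemma regular_mx_char (C : numClosedFieldType) (A : falgType C) d (b : d.+1.-tuple A)
    (chi : {lrmorphism A -> C | *%R}) (i : 'I_d.+1) :
  basis_of fullv b -> eigenvalue (regular_mx b i) (chi (tnth b i)).
Proof.
move=> b_basis; apply/eigenvalueP; exists (\row_j chi (tnth b j)).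
  apply/rowP=> j; rewrite !mxE -rmorphM /=.
  rewrite (basis_expansion b_basis (tnth b i * tnth b j)) linear_sum.
  by apply: eq_bigr => k _; rewrite !mxE linearZ /= mulrC.
apply/negP => /eqP/rowP v0.
have : chi 1 = 0.
  rewrite (basis_expansion b_basis 1) linear_sum big1 // => k _.
  by have := v0 k; rewrite !mxE linearZ /= => ->; rewrite mulr0.
by rewrite rmorph1 => /eqP; rewrite oner_eq0.
Qed.

Lemma SITAwIM_structure (C : numClosedFieldType) (A : falgType C) d
    (star : A -> A) (b : d.+1.-tuple A) (delta : 'I_d.+1 -> C) :
  SITAwIM star b delta -> symmetric_table_algebra star b ->
  exists l (dl : 'I_d.+1 -> nat),
  [/\ forall i, regular_mx b i = map_mx ratr (rat_regular_mx l i),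
      forall i, eigenvalue (map_mx ratr (rat_regular_mx l i) : 'M[C]_d.+1) (dl i)%:R,
      (forall i j k t, \sum_s l j t s * l i s k = \sum_s l i t s * l j s k)%N,
      [/\ forall i k, l i ord0 k = (i == k),
          forall i j k, (l i j k * dl k = l i k j * dl j)%N,
          forall i, (0 < dl i)%N & dl ord0 = 1%N]
    & forall f : 'I_d.+1 -> C, is_char l f -> exists2 m, (0 < m)%N &
        \sum_k f k ^+ 2 / (dl k)%:R = (\sum_k dl k)%N%:R / m%:R].
Proof.
move=> [[[_ [b_basis b0] _ bl b_inv] deg std] mulC mult] sym.
have [l lE] : exists l : 'I_d.+1 -> 'I_d.+1 -> 'I_d.+1 -> nat,
    forall i j k, struct_const b i j k = (l i j k)%:R.
  have h2 i : exists l : 'I_d.+1 -> 'I_d.+1 -> nat,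
      forall j k, struct_const b i j k = (l j k)%:R.
    have h1 j := fin_all_exists (bl i j).
    exact: (fin_all_exists h1).
  exact: (fin_all_exists h2).
pose dl i := l i i ord0.
have dlE i : delta i = (dl i)%:R by rewrite -std sym -lE.
have c1 i j : Defs.coef1 b (tnth b i * tnth b j) = (l i j ord0)%:R by rewrite -lE.
have dl_gt0 i : (0 < dl i)%N.
  by rewrite -(ltr0n C) -c1; apply/b_inv; rewrite sym.
have l0 i j : l i j ord0 = ((i == j) * dl j)%N.
  have [->|ij] := eqVneq i j; first by rewrite mul1n.
  apply/eqP; rewrite mul0n -leqn0 leqNgt -(ltr0n C) -c1; apply/negP => /b_inv.
  rewrite sym => /(congr1 (coord b i)) /eqP.
  by rewrite !coord_tnth // (negPf ij) eqxx eq_sym oner_eq0.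
have reg i : regular_mx b i = map_mx ratr (rat_regular_mx l i).
  by apply/matrixP=> k j; rewrite !mxE lE ratr_nat.
have l1 := struct_const1 b_basis b0 lE.
(* The coefficient of 1 in a triple product is computed in two orders. *)
have l_dl i j k : (l i j k * dl k = l i k j * dl j)%N.
  have E u v : Defs.coef1 b (tnth b i * tnth b u * tnth b v) = (l i u v * dl v)%N%:R.
    rewrite (basis_mul b_basis lE) mulr_suml /Defs.coef1 linear_sum.
    rewrite (bigD1 v) //= big1 => [|s sv].
      by rewrite addr0 -scalerAl linearZ /= -/(Defs.coef1 _ _) c1 l0 eqxx mul1n natrM.
    by rewrite -scalerAl linearZ /= -/(Defs.coef1 _ _) c1 l0 (negPf sv) mul0n mulr0.
  by apply/eqP; rewrite -(eqr_nat C) -!E -!mulrA (mulC (tnth b j)).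
have dl1 : dl ord0 = 1%N by rewrite /dl l1 eqxx.
have lA i j k t := struct_constA b_basis lE i j k t mulC.
exists l, dl; split=> //.
  by move=> i; rewrite -reg -dlE; have [] := deg i.
move=> f fP; have [chi chiE] := char_lrmorphism b_basis b0 lE fP.
have [m m_gt0 [_ mE]] := mult chi; exists m => //.
rewrite /order_of in mE; rewrite natr_sum -(eq_bigr _ (fun k _ => dlE k)) -mE.
apply: eq_bigr => k _; rewrite chiE dlE; congr (_ / _).
by rewrite normCK (char_real l_dl dl_gt0 k fP) expr2.
Qed.

(** * Rational polynomials and their complex roots *)

Section RationalPolynomials.

Variable C : numClosedFieldType.
Local Notation pQ p := (map_poly (@ratr C) p).

(** [g - c] shares the root [x] with the irreducible [q], hence is a multiple of [q] and vanishes at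
    [y]. *)
Lemma irreducible_conjugate (q g : {poly rat}) (x y : C) (c : rat) :
  irreducible_poly q -> root (pQ q) x -> root (pQ q) y ->
  (pQ g).[x] = ratr c -> (pQ g).[y] = ratr c.
Proof.
move=> q_irr qx qy gx; pose h := g - c%:P.
have hE z : (pQ h).[z] = (pQ g).[z] - ratr c by rewrite rmorphB /= map_polyC !hornerE.
have : q %| h.
  apply: contraT => q_h; have := irreducible_poly_coprime h q_irr.
  rewrite q_h -(coprimep_map (@ratr C)) => /coprimep_root /(_ qx).
  by rewrite hE gx subrr eqxx.
case/dvdpP=> k hk; apply/eqP; rewrite -subr_eq0 -hE hk rmorphM hornerM.
by rewrite (rootP qy) mulr0.
Qed.

Lemma reducible_cubic_cyclotomic (q : {poly rat}) (a : rat) (x : C) :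
  q \is monic -> size q = 4 -> root q a -> root (pQ q) x -> cyclotomic_number x.
Proof.
move=> q_mon sz_q /factor_theorem[q2 Dq] qx.
have q2_mon : q2 \is monic by move: q_mon; rewrite Dq monicMr ?monicXsubC.
have sz_q2 : size q2 = 3.
  move: sz_q; rewrite Dq size_Mmonic ?monicXsubC ?monic_neq0 //.
  by rewrite size_XsubC addn2 => -[].
move: qx; rewrite Dq rmorphM /= map_polyXsubC rootM root_XsubC => /orP[q2x|/eqP->].
  apply: (@quadratic_cyclotomic _ x q2`_1 q2`_0).
  have := rootP q2x; rewrite (@horner_coef_wide _ 3) ?size_map_poly ?sz_q2 //.
  rewrite !big_ord_recl big_ord0 !coef_map /= => <-.
  have := monicP q2_mon; rewrite lead_coefE sz_q2 /= => ->.
  rewrite rmorph1; ring.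
exact: cyclotomic_ratr.
Qed.

Lemma monic_cubic_coefs (q : {poly rat}) (x1 x2 x3 : C) :
  (pQ q) = \prod_(x <- [:: x1; x2; x3]) ('X - x%:P) ->
  [/\ x1 + x2 + x3 = ratr (- q`_2), x1 * x2 + x2 * x3 + x3 * x1 = ratr q`_1
    & x1 * x2 * x3 = ratr (- q`_0)].
Proof.
rewrite !big_cons big_nil mulr1 => E.
have {}E : pQ q = 'X^3 - (x1 + x2 + x3) *: 'X^2
      + (x1 * x2 + x2 * x3 + x3 * x1) *: 'X - (x1 * x2 * x3)%:P.
  by rewrite E -!mul_polyC !(rmorphD, rmorphM) /=; ring.
have coefE i : ratr q`_i = (pQ q)`_i by rewrite coef_map.
rewrite !rmorphN /= !coefE E; split;
by rewrite !(coefD, coefN, coefZ, coefXn, coefX, coefC) /=; ring.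
Qed.

End RationalPolynomials.

(** * Structure constants of rank four *)

Section RankFour.

Variables (C : numClosedFieldType).
Variables (l : 'I_4 -> 'I_4 -> 'I_4 -> nat) (dl : 'I_4 -> nat).
Hypotheses
  (deg : forall i,
    eigenvalue (map_mx ratr (rat_regular_mx l i) : 'M[C]_4) (dl i)%:R)
  (lA : (forall i j k t, \sum_s l j t s * l i s k = \sum_s l i t s * l j s k)%N)
  (l1 : forall i k, l i ord0 k = (i == k))
  (l_dl : forall i j k, (l i j k * dl k = l i k j * dl j)%N)
  (dl_gt0 : forall i, (0 < dl i)%N) (dl1 : dl ord0 = 1%N)
  (mult : forall f : 'I_4 -> C, is_char l f -> exists2 m, (0 < m)%N &
        \sum_k f k ^+ 2 / (dl k)%:R = (\sum_k dl k)%N%:R / m%:R).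

Local Notation pQ p := (map_poly (@ratr C) p).

Lemma irreducible_cubic_discriminant (j : 'I_4) (q : {poly rat}) (x1 x2 x3 : C) :
  irreducible_poly q ->
  char_poly (rat_regular_mx l j) = q * ('X - ((dl j)%:R)%:P) ->
  pQ q = \prod_(x <- [:: x1; x2; x3]) ('X - x%:P) ->
  exists D : rat, (x1 - x2) * (x2 - x3) * (x3 - x1) = ratr D.
Proof.
move=> q_irr Dchi Dq.
have qx x : root (pQ q) x = (x \in [:: x1; x2; x3]) by rewrite Dq root_prod_XsubC.
have sz_q : size q = 4.
  by rewrite -(size_map_poly (@ratr C)) Dq size_prod_XsubC.
have q_dl (a : rat) : ~~ root q a.
  apply/negP; rewrite root_factor_theorem => /(q_irr.2).
  by rewrite size_XsubC => /(_ isT) /eqp_size; rewrite size_XsubC sz_q.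
have xs_uniq : uniq [:: x1; x2; x3].
  rewrite -separable_prod_XsubC -Dq separable_map unlock irreducible_poly_coprime //.
  have dq2 : q^`()`_2 != 0.
    rewrite coef_deriv mulrn_eq0 /=.
    have : lead_coef q != 0 by rewrite lead_coef_eq0 -size_poly_gt0 sz_q.
    by rewrite lead_coefE sz_q.
  have dq0 : q^`() != 0 by apply: contra_neq dq2 => ->; rewrite coef0.
  apply/negP => /(dvdp_leq dq0); rewrite leqNgt lt_size_deriv //.
  by rewrite -size_poly_gt0 sz_q.
have xs_uniq4 : uniq [:: (dl j)%:R; x1; x2; x3].
  by rewrite cons_uniq xs_uniq -qx andbT -(ratr_nat C) fmorph_root q_dl.
(* Index 0 is reserved for the degree; the other three are the roots of [q]. *)
pose theta (i : 'I_4) : C := nth 0 [:: (dl j)%:R; x1; x2; x3] i.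
have theta_inj : injective theta.
  by move=> i k /eqP; rewrite nth_uniq // => /eqP/val_inj.
have theta_root (i : 'I_4) : i != ord0 -> root (pQ q) (theta i).
  case: i => [[|i] //= ilt] _; rewrite qx /theta /=.
  exact: (@mem_nth _ 0 [:: x1; x2; x3] i).
have [F FP] : exists F : 'I_4 -> 'I_4 -> C,
    forall i, is_char l (F i) /\ F i j = theta i.
  apply: (@fin_all_exists _ _ (fun i f => is_char l f /\ f j = theta i)) => i.
  have [|f fP fj] := @eigenvalue_char C 3 l lA l1 j (theta i); last by exists f.
  rewrite eigenvalue_root_char -map_char_poly Dchi rmorphM /= map_polyXsubC /= ratr_nat.
  rewrite rootM root_XsubC; have [->|i0] := eqVneq i ord0; first by rewrite eqxx orbT.
  by rewrite theta_root.
have FC i : is_char l (F i) by have [] := FP i.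
have Fj i : F i j = theta i by have [] := FP i.
have F_inj : injective (F^~ j) by move=> i k; rewrite !Fj => /theta_inj.
have [m mP] : exists m : 'I_4 -> nat, forall i, (0 < m i)%N /\
    \sum_k F i k ^+ 2 / (dl k)%:R = (\sum_k dl k)%N%:R / (m i)%:R.
  apply: (@fin_all_exists _ _ (fun i m => (0 < m)%N /\ _ = _ / m%:R)) => i.
  by have [m m_gt0 mE] := mult (FC i); exists m.
have m_gt0 i : (0 < m i)%N by have [] := mP i.
have mE i := proj2 (mP i).
have [p pE] := char_poly_expr FC F_inj.
have orth := char_column_orthogonal l_dl dl_gt0 FC F_inj m_gt0 mE.
have trace := char_trace FC F_inj.
have det_sqr := det_char_table_sqr l_dl dl_gt0 FC F_inj m_gt0 mE.
have [c c0 det_V] := det_char_table FC F_inj.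
have eig k x := @eigenvalue_char_table _ _ _ _ _ FC F_inj k x.
set n := (\sum_k dl k)%N in mE orth det_sqr.
have n_gt0 : (0 < n)%N by rewrite /n (bigD1 j) //= addn_gt0 dl_gt0.
pose i1 : 'I_4 := inord 1.
have i1_neq0 : i1 != ord0 by rewrite -val_eqE /= inordK.
have conj_eq (g : {poly rat}) (a : rat) i k : i != ord0 -> k != ord0 ->
    (pQ g).[theta i] = ratr a -> (pQ g).[theta k] = ratr a.
  by move=> i0 k0; apply: irreducible_conjugate q_irr _ _; apply: theta_root.
have m_eq i : i != ord0 -> m i = m i1.
  (* [g] evaluates at [theta s] to [n / m s], a rational number, so it is constant on the
     conjugates. *)
  move=> i0; pose g := \sum_k (dl k)%:R^-1 *: p k ^+ 2.
  have gE s : (pQ g).[theta s] = n%:R / (m s)%:R.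
    rewrite -mE rmorph_sum horner_sum; apply: eq_bigr => k _.
    rewrite /= map_polyZ rmorphXn /= hornerZ horner_exp fmorphV rmorph_nat mulrC.
    by rewrite pE Fj.
  have := @conj_eq g (n%:R / (m i1)%:R) _ _ i1_neq0 i0.
  rewrite !gE fmorph_div !rmorph_nat => /(_ erefl) /mulfI H; apply/eqP.
  rewrite -(eqr_nat C) -(inj_eq invr_inj); apply/eqP/H.
  by rewrite pnatr_eq0 -lt0n.
have j_neq0 : j != ord0.
  apply/eqP=> j0; have : F ord0 j = F i1 j by rewrite j0 !(proj1 (FC _)).
  by move/F_inj/eqP; rewrite eq_sym (negPf i1_neq0).
(* The degree of b_k is attained by some character; were it a nontrivial one,
   all the three would take this value, and the orthogonality of columns
   [j, k] and [j, 0] would again give [F ord0 k = dl k]. *)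
have F0E k : F ord0 k = (dl k)%:R.
  have [->|kj] := eqVneq k j; first by rewrite Fj.
  have [i Fik] := eig k _ (deg k).
  have [<-|i_neq0] := eqVneq i ord0; first by [].
  have FE a : a != ord0 -> F a k = (dl k)%:R.
    move=> a_neq0; rewrite pE Fj -(ratr_nat C); apply: conj_eq i_neq0 a_neq0 _.
    by rewrite -Fj -pE Fik ratr_nat.
  have := orth j k; have := orth j ord0.
  rewrite (negPf j_neq0) [j == k]eq_sym (negPf kj) !mulr0 !(bigD1 ord0 (P := predT)) //=.
  rewrite !(proj1 (FC _)) mulr1.
  rewrite [X in _ + X = 0 -> _](eq_bigr (fun a => (m a)%:R * F a j)) => [|a _];
    last by rewrite (proj1 (FC _)) mulr1.
  rewrite [X in _ -> _ + X = 0 -> _]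
    (eq_bigr (fun a => (m a)%:R * F a j * (dl k)%:R)) => [|a /FE-> //].
  rewrite -mulr_suml => /eqP; rewrite addrC addr_eq0 => /eqP->.
  rewrite mulNr -mulrBr => /eqP; rewrite mulf_eq0 mulf_eq0 subr_eq0.
  rewrite pnatr_eq0 -leqn0 leqNgt m_gt0 Fj /theta /= pnatr_eq0 -leqn0 leqNgt dl_gt0.
  by move/eqP.
have m0 : m ord0 = 1%N.
  have := mE ord0; rewrite (eq_bigr (fun k => (dl k)%:R)) => [|k _]; last first.
    by rewrite F0E expr2 mulfK // pnatr_eq0 -lt0n.
  rewrite -natr_sum -/n => E; apply/eqP.
  rewrite -(eqn_pmul2l n_gt0) muln1 -(eqr_nat C) natrM {1}E divfK //.
  by rewrite pnatr_eq0 -lt0n.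
have sum_m : n = (1 + 3 * m i1)%N.
  have := orth ord0 ord0; rewrite dl1 eqxx !mulr1.
  rewrite (eq_bigr (fun i => (m i)%:R)) => [|i _]; last first.
    by rewrite !(proj1 (FC _)) !mulr1.
  rewrite -natr_sum => /eqP; rewrite eqr_nat => /eqP <-.
  rewrite (bigD1 ord0) //= m0 (eq_bigr (fun=> m i1)) => [|i /m_eq //].
  by rewrite sum_nat_const cardC1 card_ord.
(* With [t] the trace of [b_k], orthogonality of columns [k] and [ord0] reads
   [dl k + m i1 * t = m i1 * dl k], so [m i1] divides [dl k]. *)
have m_le k : k != ord0 -> (m i1 <= dl k)%N.
  move=> k_neq0; apply: dvdn_leq => //.
  have := orth k ord0; rewrite (negPf k_neq0) mulr0 (bigD1 ord0) //= m0 F0E mul1r.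
  rewrite (proj1 (FC _)) mulr1.
  rewrite (eq_bigr (fun i => (m i1)%:R * F i k)) => [|i i_neq0]; last first.
    by rewrite (proj1 (FC _)) mulr1 m_eq.
  have := trace k; rewrite (bigD1 ord0) //= F0E -mulr_sumr => /(canRL (addKr _)) ->.
  set t := (\sum_i _)%N; rewrite mulrDr mulrN addrA -natrM => /eqP.
  rewrite addrAC subr_eq0 -natrM -natrD eqr_nat => /eqP E.
  by rewrite -(dvdn_addl _ (dvdn_mulr t (dvdnn _))) E dvdn_mulr.
(* The three nontrivial degrees sum to [3 * m i1] and each is at least [m i1], so all are equal to
   it. *)
have m_dl i : m i = dl i.
  have [->|i_neq0] := eqVneq i ord0; first by rewrite m0 dl1.
  have [_] := leqif_sum (fun k k_neq0 => leqif_eq (m_le k k_neq0)).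
  rewrite sum_nat_const cardC1 card_ord.
  have : n = (1 + \sum_(k | k != ord0) dl k)%N by rewrite /n (bigD1 ord0) //= dl1.
  rewrite sum_m => /addnI <-; rewrite eqxx => /esym/forall_inP/(_ i i_neq0)/eqP <-.
  exact: m_eq.
have det2 : \det (\matrix_(i, k) F i k) ^+ 2 = (n%:R ^+ 2) ^+ 2.
  have dl_prod0 : \prod_i (dl i)%:R != 0 :> C.
    by apply/prodf_neq0 => i _; rewrite pnatr_eq0 -lt0n.
  apply: (mulIf dl_prod0); rewrite -exprM -det_sqr.
  by congr (_ * _); apply: eq_bigr => i _; rewrite m_dl.
have [e detE] : exists e : rat, \det (\matrix_(i, k) F i k) = ratr e.
  move/eqP: det2; rewrite eqf_sqr => /orP[] /eqP->.
    by exists (n%:R ^+ 2); rewrite rmorphXn /= ratr_nat.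
  by exists (- n%:R ^+ 2); rewrite rmorphN rmorphXn /= ratr_nat.
have qd : ratr q.[(dl j)%:R] = ((dl j)%:R - x1) * ((dl j)%:R - x2) * ((dl j)%:R - x3).
  by rewrite -horner_map /= ratr_nat Dq !big_cons big_nil mulr1 !hornerE.
have qd0 : ratr q.[(dl j)%:R] != 0 :> C by rewrite fmorph_eq0; exact: q_dl.
(* The Vandermonde determinant of the degree and the three roots is [- q.[dl j]] times the product
   of differences. *)
exists (- (e * c) / q.[(dl j)%:R]).
rewrite fmorph_div rmorphN rmorphM /= -detE -det_V det_Vandermonde.
apply: (canRL (mulfK qd0)); rewrite qd.
under eq_bigr do rewrite big_mkcond !big_ord_recl big_ord0 /=.
rewrite !big_ord_recl big_ord0 !mxE !Fj /theta /=; ring.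
Qed.

Theorem rank_four_cyclotomic (j : 'I_4) (x : C) :
  eigenvalue (map_mx ratr (rat_regular_mx l j)) x -> cyclotomic_number x.
Proof.
set p := char_poly (rat_regular_mx l j).
have eigE y : eigenvalue (map_mx ratr (rat_regular_mx l j)) y = root (pQ p) y.
  by rewrite eigenvalue_root_char map_char_poly.
have /factor_theorem[q Dp] : root p (dl j)%:R.
  by have := deg j; rewrite eigE -(ratr_nat C) fmorph_root.
have q_mon : q \is monic.
  by have := char_poly_monic (rat_regular_mx l j); rewrite -/p Dp monicMr ?monicXsubC.
have sz_q : size q = 4.
  have := size_char_poly (rat_regular_mx l j); rewrite -/p Dp.
  by rewrite size_Mmonic ?monicXsubC ?monic_neq0 // size_XsubC addn2 => -[].
rewrite eigE Dp rmorphM /= map_polyXsubC rootM root_XsubC.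
case/orP=> [qx|/eqP->]; last exact: cyclotomic_ratr.
have [rs Dq] := closed_field_poly_normal (pQ q).
move: Dq; rewrite (monicP (monic_map _ q_mon)) scale1r => Dq.
have : size rs = 3.
  by apply: succn_inj; rewrite -(size_prod_XsubC rs id) -Dq size_map_poly.
case: rs Dq => [|x1 [|x2 [|x3 [|]]]] // Dq _.
have [[a qa]|no_root] := EM (exists a, root q a).
  exact: reducible_cubic_cyclotomic q_mon sz_q qa qx.
have q_irr : irreducible_poly q.
  apply: cubic_irreducible; first by rewrite sz_q.
  by move=> a; apply/negP => qa; apply: no_root; exists a.
have [D DE] := irreducible_cubic_discriminant q_irr Dp Dq.
have [E1 E2 E3] := monic_cubic_coefs Dq.
move: qx; rewrite Dq root_prod_XsubC !inE => /or3P[] /eqP->.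
- exact: cubic_cyclotomic E1 E2 E3 DE.
(* Cyclic permutations of the roots preserve the product of differences, sign included. *)
- apply: (@cubic_cyclotomic _ x2 x3 x1 (- q`_2) q`_1 (- q`_0) D).
  + by rewrite -E1; ring.
  + by rewrite -E2; ring.
  + by rewrite -E3; ring.
  by rewrite -DE; ring.
- apply: (@cubic_cyclotomic _ x3 x1 x2 (- q`_2) q`_1 (- q`_0) D).
  + by rewrite -E1; ring.
  + by rewrite -E2; ring.
  + by rewrite -E3; ring.
  by rewrite -DE; ring.
Qed.

End RankFour.

(** * Specialisation to the complex numbers *)

Local Open Scope complex_scope.

Theorem theorem3p2 (R : realType) (A : falgType R[i]) (star : A -> A)
    (b : 4.-tuple A) (delta : 'I_4 -> R[i])
    (hA : SITAwIM star b delta) (hsym : symmetric_table_algebra star b) :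
  (forall (i : 'I_4) (x : R[i]),
     eigenvalue (regular_mx b i) x -> cyclotomic_number x) /\
  (forall (chi : {lrmorphism A -> R[i] | *%R}) (j : 'I_4),
     cyclotomic_number (chi (tnth b j))).
Proof.
have [l [dl [reg deg lA [l1 l_dl dl_gt0 dl1] mult]]] := SITAwIM_structure hA hsym.
have eig i x : eigenvalue (regular_mx b i) x -> cyclotomic_number x.
  rewrite reg; exact: (rank_four_cyclotomic deg lA l1 l_dl dl_gt0 dl1 mult).
split=> // chi j; apply: (eig j); apply: regular_mx_char.
by case: hA => [[[_ [? _] _ _ _] _ _] _ _].
Qed.
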